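(* Let $k=k(m)\ge 1$ be integers with $k=o(m)$ as $m\to\infty$, and set $n=mk$. Then for every balanced sequence of partitions $\nu\vdash mk$, \[ \langle L_{(m^k)}, s_\nu\rangle \sim \frac{f^\nu}{m^k\,k!}\quad\text{as } m\to\infty . \] Consequently the sequence of higher Lie characters $\psi^{(m^k)}$ indexed by the rectangles $(m^k)$ tends to be regular.
   Context: $(m^k)$ denotes the rectangular partition with $k$ rows of length $m$; note $z_{(m^k)}=m^k k!$, where for $\lambda=(1^{m_1}2^{m_2}\cdots)$, $z_\lambda=\prod_i i^{m_i}m_i!$. For $\nu\vdash n$, $f^\nu$ is the number of standard Young tableaux of shape $\nu$, $\chi^\nu$ the irreducible character of $\mathfrak S_n$, $s_\nu$ the Schur function, $\langle\cdot,\cdot\rangle$ the Hall inner product. For $\lambda=(1^{m_1}2^{m_2}\cdots)\vdash n$, let $Z_\lambda\cong\prod_i \mathfrak S_{m_i}[\mathbb Z_i]$ be the centralizer of a permutation of cycle type $\lambda$, where $\mathbb Z_i$ is the cyclic group generated by an $i$-cycle; let $\zeta_i$ be a primitive (faithful) linear character of $\mathbb Z_i$ and $\mathrm{id}_{m_i}[\zeta_i]$ the character of the wreath product $\mathfrak S_{m_i}[\mathbb Z_i]$ obtained from $\zeta_i$ and the trivial character of $\mathfrak S_{m_i}$. The higher Lie character is $\psi^\lambda=\mathrm{Ind}_{Z_\lambda}^{\mathfrak S_n}(\mathrm{id}_{m_1}[\zeta_1]\otimes\mathrm{id}_{m_2}[\zeta_2]\otimes\cdots)$, of degree $n!/z_\lambda$,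 and $L_\lambda$ is its Frobenius characteristic. A family of partitions $\nu\vdash n$ is balanced if there is a constant $a$ with $\nu_1,\nu'_1\le a\sqrt n$ (first row and first column lengths). A sequence of characters $\rho_n$ tends to be regular if $\langle\rho_n,\chi^{\nu^{(n)}}\rangle/\rho_n(1)\sim f^{\nu^{(n)}}/n!$ for Plancherel-typical $(\nu^{(n)})$; Plancherel-typical sequences are balanced, and for $\rho=\psi^\lambda$ the condition reads $\langle L_\lambda,s_\nu\rangle\sim f^\nu/z_\lambda$. *)

(* Defs.v *)
From HB Require Import structures.
From mathcomp Require Import all_boot all_order all_algebra all_fingroup.
From mathcomp Require Import algC.
From mathcomp Require Import mpoly.
Unset Printing Implicit Defensive.
Import Order.TTheory GRing.Theory Num.Theory.
Local Open Scope ring_scope.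

Definition is_partition (n : nat) (nu : seq nat) : bool :=
  [&& sorted geq nu, all (fun p => 0 < p)%N nu & sumn nu == n].

Definition in_diagram (nu : seq nat) (c : nat * nat) : bool := (c.2 < nth 0 nu c.1)%N.

(* A standard Young tableau of shape nu |- n, encoded by the map sending each
   entry t (0-based, t < n) to its cell: injective onto the diagram, and
   entries increase along rows and down columns. *)
Definition is_SYT (n : nat) (nu : seq nat) (T : {ffun 'I_n -> ('I_n * 'I_n)%type}) : bool :=
  [&& [forall t, in_diagram nu (val (T t).1, val (T t).2)],
      injectiveb T &
      [forall a, forall b,
         ((val (T a).1 <= val (T b).1)%N && (val (T a).2 <= val (T b).2)%N) ==> (a <= b)%N]].

Definition fSYT (n : nat) (nu : seq nat) : nat := #|[pred T : {ffun 'I_n -> ('I_n * 'I_n)%type} | is_SYT n nu T]|.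

(* ---------- irreducible characters chi^nu (Frobenius formula) ---------- *)
Definition pow_sum (n r : nat) : {mpoly int[n]} := \sum_(i < n) 'X_i ^+ r.

Definition p_type (n : nat) (g : {perm 'I_n}) : {mpoly int[n]} :=
  \prod_(C in porbits g) pow_sum n #|C|.

Definition vandermonde (n : nat) : {mpoly int[n]} :=
  \prod_(i < n) \prod_(j < n | (i < j)%N) ('X_i - 'X_j).

Definition irr_char (n : nat) (nu : seq nat) (g : {perm 'I_n}) : int :=
  (vandermonde n * p_type n g)@_[multinom (nth 0 nu i + (n - 1 - i))%N | i < n].

(* The fixed permutation c of cycle type (m^k) on {0,...,mk-1}:
   c(b*m + t) = b*m + (t+1 mod m), i.e. the product of the m-cycles on the
   blocks {b*m, ..., b*m + m-1}. *)
Definition rect_cycle (m k : nat) (i : 'I_(m * k)) : 'I_(m * k) :=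
  insubd i ((val i %/ m) * m + (val i %% m).+1 %% m)%N.

Definition rect_centralizer (m k : nat) : {set {perm 'I_(m * k)}} :=
  [set z : {perm 'I_(m * k)} | [forall i, z (rect_cycle m k i) == rect_cycle m k (z i)]].

(* The linear character id_k[zeta] of Z ~ S_k[Z_m]: z maps the base point b*m
   of block b to some b'*m + t'_b, i.e. acts as (sigma; t'_0, ..., t'_(k-1));
   its value is omega^(sum_b t'_b), omega = zeta(c_b) a primitive m-th root. *)
Definition rect_lin_char (m k : nat) (omega : algC) (z : {perm 'I_(m * k)}) : algC :=
  omega ^+ (\sum_(i : 'I_(m * k) | (val i %% m == 0)%N) (val (z i) %% m))%N.

(* psi^(m^k) = Ind_Z^(S_mk) id_k[zeta], by the definition of induced characters *)
Definition higher_lie_rect (m k : nat) (omega : algC) (g : {perm 'I_(m * k)}) : algC :=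
  (#|rect_centralizer m k|%:R)^-1 *
  \sum_(x : {perm 'I_(m * k)})
     (if (g ^ x)%g \in rect_centralizer m k then rect_lin_char m k omega (g ^ x)%g else 0).

(* <L_(m^k), s_nu> = <psi^(m^k), chi^nu>  (character inner product on S_mk) *)
Definition lie_mult (m k : nat) (omega : algC) (nu : seq nat) : algC :=
  (#|[set: {perm 'I_(m * k)}]|%:R)^-1 *
  \sum_(g : {perm 'I_(m * k)}) higher_lie_rect m k omega g * ((irr_char (m * k) nu g)%:~R)^*.

(* A family nu(m) |- n(m) is balanced: exists a, nu_1, nu'_1 <= a sqrt n
   (squared form; integer a is no loss of generality). *)
Definition balanced (n : nat -> nat) (nu : nat -> seq nat) : Prop :=
  exists a : nat, forall m,
    (head 0 (nu m) ^ 2 <= a ^ 2 * n m)%N /\ (size (nu m) ^ 2 <= a ^ 2 * n m)%N.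

(* Main.v *)
(** By Frobenius reciprocity the multiplicity is the average over the centralizer
    Z = S_k[Z_m] of phi(z) chi^nu(z). The identity contributes f^nu / |Z|, so it suffices
    that the sum of |chi^nu(z)| over z <> 1 in Z is o(f^nu).

    Partitions are encoded by the beads l = nu + delta. Then f(l) = [bdim N l] =
    N! prod |l_a - l_b| / prod l_i! is the number of standard tableaux, and Frobenius' formula
    gives the Murnaghan-Nakayama recursion: move one bead down by r. The key estimate is
    |chi^kappa(w)|^2 <= 4^N f^kappa for kappa |- N and w without fixed points. It is proved one
    cycle at a time. A ribbon of length r >= 2 contains two cells that can be removed in turn,
    and f is almost log-concave under removing two cells, so that f(kappa) f(kappa - ribbon) is
    at most 4 times the square of the sum of f(kappa - c) over the corners c in the ribbon.
    Hence the sum of sqrt f(kappa - ribbon) over all ribbons is at most 2 r sqrt f(kappa):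
    each corner lies in at most r ribbons, and the f(kappa - c) add up to f(kappa).

    If nu is balanced, all hook lengths are at most h = O(sqrt n), whence
    f^kappa >= N! / h^N >= (N / 4h)^N for kappa in nu with N cells. Stripping the fixed points
    of z first and using h = o(m) (this is k = o(m)), one gets |chi^nu(z)| <= 2^(-N) f^nu for
    every z in Z with N > 0 non-fixed points. Finally N is m times the number of moved blocks,
    and z is determined by the images of the k base points, so the sum over z <> 1 is at most
    ((1 + n 2^(-m))^k - 1) f^nu. *)
Require Import Defs.
From mathcomp Require Import all_boot all_order all_algebra all_fingroup.
From mathcomp Require Import algC.
From mathcomp Require Import mpoly zify ring lra.

Set Implicit Arguments.
Unset Strict Implicit.
Import Order.TTheory GRing.Theory Num.Theory.
Local Open Scope ring_scope.

(** * Falling factorial determinants *)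

Definition falling_poly (j : nat) : {poly rat} := \prod_(t < j) ('X - t%:R%:P).

Lemma falling_poly_horner (x j : nat) : (falling_poly j).[x%:R] = (x ^_ j)%:R.
Proof.
elim: j => [|j IHj]; first by rewrite /falling_poly big_ord0 hornerC.
rewrite /falling_poly big_ord_recr /= hornerM [X in X * _]IHj hornerXsubC ffactnSr.
case: (leqP j x) => [le_jx|lt_xj]; first by rewrite natrM natrB.
by rewrite ffact_small // mul0n mul0r.
Qed.

Lemma falling_poly_monic j : falling_poly j \is monic.
Proof. by apply: monic_prod => t _; exact: monicXsubC. Qed.

Lemma size_falling_poly j : size (falling_poly j) = j.+1.
Proof. by rewrite /falling_poly size_prod_XsubC [index_enum _]unlock -enumT size_enum_ord. Qed.

Definition ffdet n (l : 'I_n -> nat) : rat :=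
  \det (\matrix_(i < n, j < n) (l i ^_ j)%:R).

(** The j-th falling factorial is a monic polynomial of degree j, so a unitriangular change of basis
    turns the matrix into a Vandermonde matrix. *)
Lemma ffdetE n (l : 'I_n -> nat) :
  ffdet l = \prod_(i < n) \prod_(j < n | (i < j)%N) ((l j)%:R - (l i)%:R).
Proof.
pose T : 'M[rat]_n := \matrix_(j, k) (falling_poly j)`_k.
pose a : 'rV[rat]_n := \row_i (l i)%:R.
have -> : ffdet l = \det (T *m Vandermonde n a)^T.
  congr (\det _); apply/matrixP => i j; rewrite !mxE -falling_poly_horner.
  rewrite (horner_coef_wide (n := n)) ?size_falling_poly //.
  by apply: eq_bigr => k _; rewrite !mxE.
rewrite det_tr det_mulmx det_trig; last first.
  apply/is_trig_mxP => i j lt_ij; rewrite mxE nth_default //.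
  by rewrite size_falling_poly.
rewrite big1 ?mul1r ?det_Vandermonde; last first.
  move=> i _; rewrite mxE; have := falling_poly_monic i.
  by rewrite monicE lead_coefE size_falling_poly => /eqP.
by apply: eq_bigr => i _; apply: eq_bigr => j _; rewrite !mxE.
Qed.

Definition upd n (l : 'I_n -> nat) (i : 'I_n) (t : nat) : 'I_n -> nat :=
  fun j => if j == i then t else l j.

Lemma upd_same n (l : 'I_n -> nat) i t : upd l i t i = t.
Proof. by rewrite /upd eqxx. Qed.

Lemma upd_neq n (l : 'I_n -> nat) i j t : j != i -> upd l i t j = l j.
Proof. by rewrite /upd => /negPf ->. Qed.

Lemma eq_ffdet n (l l' : 'I_n -> nat) : l =1 l' -> ffdet l = ffdet l'.
Proof.
by move=> E; congr (\det _); apply/matrixP => i j; rewrite !mxE E.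
Qed.

(* x (x-1)^_j = x^_(j+1) = (x - j) x^_j, so lowering row i multiplies the Leibniz term
   of s by l_i - s(i). *)
Lemma ffdet_rec n (l : 'I_n -> nat) :
  \sum_i (l i)%:R * ffdet (upd l i (l i).-1) =
  ((\sum_i l i)%:R - 'C(n, 2)%:R) * ffdet l.
Proof.
have ffdet_leibniz l' : ffdet l' = \sum_(s : {perm 'I_n}) (-1) ^+ s *
    \prod_i (\matrix_(i1, j) (l' i1 ^_ j)%:R) i (s i) by [].
under [LHS]eq_bigr => i _ do rewrite ffdet_leibniz mulr_sumr.
rewrite exchange_big /= ffdet_leibniz mulr_sumr /=; apply: eq_bigr => s _.
set P := (X in _ = _ * (_ * X)).
have step i : (l i)%:R * ((-1) ^+ s *
   \prod_i0 (\matrix_(i1, j) (upd l i (l i).-1 i1 ^_ j)%:R) i0 (s i0)) =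
   ((l i)%:R - (s i : nat)%:R) * ((-1) ^+ s * P) :> rat.
  rewrite mulrCA [RHS]mulrCA; congr (_ * _).
  rewrite /P (bigD1 i) //= [in RHS](bigD1 i) //= !mxE upd_same !mulrA.
  congr (_ * _); last first.
    by apply: eq_bigr => j nji; rewrite !mxE upd_neq.
  rewrite -natrM -ffactnS ffactnSr natrM mulrC.
  case: (leqP (s i) (l i)) => [le|lt]; first by rewrite natrB.
  by rewrite ffact_small // !(mul0r, mulr0).
rewrite (eq_bigr _ (fun i _ => step i)) -mulr_suml sumrB -natr_sum -natr_sum.
congr ((_ - _%:R) * _).
rewrite -(reindex_inj (h := s) (F := fun i : 'I_n => i : nat) (P := xpredT) perm_inj).
by rewrite -triangular_sum big_mkord.
Qed.

(** * The dimension function on bead configurations *)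

(** Keeping the sign of the order of the beads makes this alternating in [l]: moves onto an occupied
    place vanish by themselves, and the recursion becomes a determinant identity. *)
Definition sdim n (N : nat) (l : 'I_n -> nat) : rat :=
  N`!%:R * ffdet l / \prod_i (l i)`!%:R.

Definition bdim n (N : nat) (l : 'I_n -> nat) : rat := `|sdim N l|.

Lemma prod_fact_gt0 n (l : 'I_n -> nat) : 0 < \prod_i (l i)`!%:R :> rat.
Proof. by apply: prodr_gt0 => i _; rewrite ltr0n fact_gt0. Qed.

Lemma eq_sdim n N (l l' : 'I_n -> nat) : l =1 l' -> sdim N l = sdim N l'.
Proof.
move=> E; rewrite /sdim (eq_ffdet E); congr (_ / _).
by apply: eq_bigr => i _; rewrite E.
Qed.

Lemma eq_bdim n N (l l' : 'I_n -> nat) : l =1 l' -> bdim N l = bdim N l'.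
Proof. by move=> E; rewrite /bdim (eq_sdim N E). Qed.

Lemma bdim_ge0 n N (l : 'I_n -> nat) : 0 <= bdim N l.
Proof. exact: normr_ge0. Qed.

Lemma ffdet_dup n (l : 'I_n -> nat) i j : i != j -> l i = l j -> ffdet l = 0.
Proof.
move=> nij E; apply: (determinant_alternate nij) => k.
by rewrite !mxE E.
Qed.

Lemma bdim_dup n N (l : 'I_n -> nat) i j : i != j -> l i = l j -> bdim N l = 0.
Proof. by move=> nij E; rewrite /bdim /sdim (ffdet_dup nij E) mulr0 mul0r normr0. Qed.

Lemma bdim_gt0 n N (l : 'I_n -> nat) : injective l -> 0 < bdim N l.
Proof.
move=> inj; rewrite normr_gt0 /sdim !mulf_neq0 //.
- by rewrite pnatr_eq0 -lt0n fact_gt0.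
- rewrite ffdetE; apply/prodf_neq0 => i _; apply/prodf_neq0 => j lt_ij.
  rewrite subr_eq0 eqr_nat; apply: contraL lt_ij => /eqP/inj ->.
  by rewrite ltnn.
by rewrite invr_eq0 gt_eqF // prod_fact_gt0.
Qed.

Lemma prod_upd_pred n (l : 'I_n -> nat) i : (0 < l i)%N ->
  \prod_j (l j)`!%:R = (l i)%:R * \prod_j (upd l i (l i).-1 j)`!%:R :> rat.
Proof.
move=> gt0; rewrite (bigD1 i) //= [in RHS](bigD1 i) //= upd_same mulrA.
congr (_ * _); first by rewrite -natrM -{1}(prednK gt0) factS prednK.
by apply: eq_bigr => j nji; rewrite upd_neq.
Qed.

(** This is [ffdet_rec] divided by the factorials; the assumption on the sum turns its scalar into
    N+1, which completes N! to (N+1)!. *)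
Lemma sdim_rec n N (l : 'I_n -> nat) : (\sum_i l i = 'C(n, 2) + N.+1)%N ->
  sdim N.+1 l = \sum_(i | (0 < l i)%N) sdim N (upd l i (l i).-1).
Proof.
move=> sl; have := ffdet_rec l; rewrite sl natrD addrC addKr => E.
rewrite /sdim factS natrM [_.+1%:R * _]mulrC -[_ * _ * ffdet _]mulrA -E.
rewrite mulr_sumr mulr_suml (bigID (fun i => 0 < l i)%N) /=.
rewrite [X in _ + X]big1 ?addr0; last first.
  by move=> i; rewrite -eqn0Ngt => /eqP ->; rewrite mul0r mulr0 mul0r.
apply: eq_bigr => i gt0; rewrite (prod_upd_pred gt0) -!mulrA; congr (_ * _).
rewrite mulrCA; congr (_ * _); rewrite invfM mulrA mulfV ?mul1r //.
by rewrite pnatr_eq0 -lt0n.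
Qed.

(** A bead lowered by one cannot jump over another bead, so each difference in the Vandermonde
    product keeps its sign or becomes 0. *)
Lemma sdim_same_sign n N M (l : 'I_n -> nat) i : injective l ->
  0 <= sdim N l * sdim M (upd l i (l i).-1).
Proof.
move=> inj; have inv_ge0 (l' : 'I_n -> nat) : 0 <= (\prod_i (l' i)`!%:R)^-1 :> rat.
  by rewrite invr_ge0 ltW ?prod_fact_gt0.
rewrite /sdim mulrACA; apply: mulr_ge0; last by rewrite mulr_ge0.
rewrite mulrACA; apply: mulr_ge0; first by rewrite mulr_ge0.
rewrite !ffdetE -big_split /=.
apply: prodr_ge0 => a _; rewrite -big_split /=; apply: prodr_ge0 => b lt_ab.
have nab : l a != l b by apply: contraL lt_ab => /eqP/inj ->; rewrite ltnn.
rewrite /upd; case: eqP => [ebi|_]; case: eqP => [eai|_]; subst.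
- by rewrite ltnn in lt_ab.
- case: (ltnP (l a) (l i)) => [lt|le].
    by rewrite mulr_ge0 // subr_ge0 ler_nat; lia.
  by rewrite mulr_le0 // subr_le0 ler_nat; lia.
- case: (ltnP (l b) (l i)) => [lt|le].
    by rewrite mulr_le0 // subr_le0 ler_nat; lia.
  by rewrite mulr_ge0 // subr_ge0 ler_nat; lia.
- by rewrite -expr2 sqr_ge0.
Qed.

(** Branching rule: by [sdim_same_sign] nothing cancels in [sdim_rec], so absolute values may be
    taken termwise. *)
Lemma bdim_rec n N (l : 'I_n -> nat) : injective l ->
  (\sum_i l i = 'C(n, 2) + N.+1)%N ->
  bdim N.+1 l = \sum_(i | (0 < l i)%N) bdim N (upd l i (l i).-1).
Proof.
move=> inj sl; have gt0 := bdim_gt0 N.+1 inj.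
have sgn i : bdim N (upd l i (l i).-1) =
    Num.sg (sdim N.+1 l) * sdim N (upd l i (l i).-1).
  have := sdim_same_sign N.+1 N i inj.
  set x := sdim N.+1 l in gt0 *; set y := sdim N _ => xy.
  rewrite -[RHS]ger0_norm; last by rewrite -sgr_ge0 sgrM sgr_id -sgrM sgr_ge0.
  by rewrite normrM normr_sg -normr_gt0 gt0 mul1r.
rewrite (eq_bigr _ (fun i _ => sgn i)) -mulr_sumr -sdim_rec //.
exact: normrEsg.
Qed.

Definition pairprod n (P : pred 'I_n) (h : 'I_n -> 'I_n -> rat) : rat :=
  \prod_(a | P a) \prod_(b | P b && (a < b)%N) h a b.

Lemma pairprodD1 n (P : pred 'I_n) (h : 'I_n -> 'I_n -> rat) i :
  (forall a b, h a b = h b a) -> P i ->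
  pairprod P h = (\prod_(j | P j && (j != i)) h i j) *
                 pairprod (fun j => P j && (j != i)) h.
Proof.
move=> hC Pi; rewrite /pairprod (bigD1 i) //=.
have inner a : P a && (a != i) -> \prod_(b | P b && (a < b)%N) h a b =
   (if (a < i)%N then h a i else 1) *
   \prod_(b | P b && (b != i) && (a < b)%N) h a b.
  move=> /andP[Pa nai]; case: ifP => [lt|/negbT nlt].
    rewrite (bigD1 i) ?Pi //=; congr (_ * _).
    by apply: eq_bigl => b; rewrite andbAC.
  rewrite mul1r; apply: eq_bigl => b; rewrite andbAC.
  by case: eqP => [->|_]; rewrite ?andbT // (negPf nlt) !andbF.
rewrite (eq_bigr _ inner) big_split /= mulrA; congr (_ * _).
rewrite [X in X * _](_ : _ = \prod_(j | P j && (j != i))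
   if (i < j)%N then h i j else 1); last first.
  rewrite -big_mkcondr /=; apply: eq_bigl => b.
  by case: eqP => [->|_]; rewrite ?ltnn ?andbF ?andbT.
rewrite -big_split /=; apply: eq_bigr => j /andP[_ nji].
case: ltngtP => [_|_|E]; first by rewrite mulr1.
  by rewrite mul1r hC.
by rewrite (ord_inj E) eqxx in nji.
Qed.

Definition natdist (a b : nat) : rat := `|a%:R - b%:R|.

Lemma natdistC a b : natdist a b = natdist b a.
Proof. exact: distrC. Qed.

Lemma bdimE n N (l : 'I_n -> nat) :
  bdim N l = N`!%:R * pairprod xpredT (fun a b => natdist (l a) (l b)) /
             \prod_i (l i)`!%:R.
Proof.
rewrite /bdim /sdim normrM normrM normrV ?unitfE ?gt_eqF ?prod_fact_gt0 //.
rewrite normr_nat (gtr0_norm (prod_fact_gt0 l)); congr (_ * _ / _).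
rewrite ffdetE normr_prod; apply: eq_bigr => i _; rewrite normr_prod.
by apply: eq_bigr => j _; rewrite natdistC.
Qed.

(** All factors without bead [i] go into [K]. It is the same for every N and every position of bead
    [i], so it cancels when such configurations are compared. *)
Lemma bdim_one n (l : 'I_n -> nat) i : exists2 K : rat, 0 <= K &
  forall N l', (forall k, k != i -> l' k = l k) ->
  bdim N l' = N`!%:R * K * (\prod_(k | k != i) natdist (l' i) (l k)) / (l' i)`!%:R.
Proof.
exists (pairprod (fun k => k != i) (fun a b => natdist (l a) (l b)) /
         \prod_(k | k != i) (l k)`!%:R).
  rewrite mulr_ge0 ?invr_ge0 ?prodr_ge0 // => a _; apply: prodr_ge0 => b _.
  exact: normr_ge0.
move=> N l' E; rewrite bdimE (pairprodD1 (i := i)) //=; last first.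
  by move=> a b; rewrite natdistC.
rewrite [X in _ / X](bigD1 i) //= invfM.
rewrite (eq_bigr (fun k => natdist (l' i) (l k))); last by move=> k /E ->.
rewrite [X in _ / (X)](eq_bigr (fun k => (l k)`!%:R)); last by move=> k /E ->.
have -> : pairprod (fun k => k != i) (fun a b => natdist (l' a) (l' b)) =
   pairprod (fun k => k != i) (fun a b => natdist (l a) (l b)).
  by apply: eq_bigr => a na; apply: eq_bigr => b /andP[nb _]; rewrite !E.
by move: (_^-1) (_^-1) => u v; ring.
Qed.

Lemma bdim_two n (l : 'I_n -> nat) i j : i != j -> exists2 K : rat, 0 <= K &
  forall N l', (forall k, k != i -> k != j -> l' k = l k) ->
  bdim N l' = N`!%:R * K * natdist (l' i) (l' j) *
    (\prod_(k | (k != i) && (k != j)) (natdist (l' i) (l k) * natdist (l' j) (l k)))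
    / ((l' i)`!%:R * (l' j)`!%:R).
Proof.
move=> nij; pose Q k := (k != i) && (k != j).
exists (pairprod Q (fun a b => natdist (l a) (l b)) /
         \prod_(k | Q k) (l k)`!%:R).
  rewrite mulr_ge0 ?invr_ge0 ?prodr_ge0 // => a _; apply: prodr_ge0 => b _.
  exact: normr_ge0.
move=> N l' E; rewrite bdimE (pairprodD1 (i := i)) //=; last first.
  by move=> a b; rewrite natdistC.
rewrite (pairprodD1 (i := j)) //=; last 2 first.
- by move=> a b; rewrite natdistC.
- by rewrite eq_sym.
rewrite [X in _ / X](bigD1 i) //= [X in _ / (_ * X)](bigD1 j) /=; last by rewrite eq_sym.
rewrite [X in _ * (X * _) / _](bigD1 j) /=; last by rewrite eq_sym.
have EQ k : Q k -> l' k = l k by case/andP=> ? ?; apply: E.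
rewrite (eq_bigr (P := fun k => (k != i) && (k != j))
  (fun k => natdist (l' i) (l k))); last by move=> k /EQ ->.
rewrite [\prod_(k | (k != i) && (k != j)) natdist (l' j) (l' k)](eq_bigr
  (fun k => natdist (l' j) (l k))); last by move=> k /EQ ->.
rewrite [\prod_(k | (k != i) && (k != j)) (l' k)`!%:R](eq_bigr
  (fun k => (l k)`!%:R)); last by move=> k /EQ ->.
have -> : pairprod (fun k => (k != i) && (k != j)) (fun a b => natdist (l' a) (l' b)) =
   pairprod Q (fun a b => natdist (l a) (l b)).
  by apply: eq_bigr => a na; apply: eq_bigr => b /andP[nb _]; rewrite !EQ.
by rewrite big_split /= !invfM; move: (_^-1) (_^-1) (_^-1) => u v w; ring.
Qed.

Lemma sum_upd n (l : 'I_n -> nat) i t :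
  (\sum_j upd l i t j + l i = \sum_j l j + t)%N.
Proof.
rewrite (bigD1 i) //= [in RHS](bigD1 i) //= upd_same.
rewrite (eq_bigr l); first by rewrite -addnA addnC [(_ + l i)%N]addnC.
by move=> j nji; rewrite upd_neq.
Qed.

Lemma sum_upd_sub n (l : 'I_n -> nat) i r c : (r <= l i)%N ->
  (\sum_j l j = c + r)%N -> (\sum_j upd l i (l i - r) j = c)%N.
Proof. by move=> rl E; have := sum_upd l i (l i - r); rewrite E; lia. Qed.

Lemma upd_inj n (l : 'I_n -> nat) i t :
  injective l -> (forall k, k != i -> l k != t) -> injective (upd l i t).
Proof.
move=> inj nt a b; rewrite /upd.
case: eqP => [->|/eqP na]; case: eqP => [->|/eqP nb] // E; last exact: inj.
  by have := nt b nb; rewrite -E eqxx.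
by have := nt a na; rewrite E eqxx.
Qed.

Lemma bdim_swap n N (l : 'I_n -> nat) i j a b : i != j ->
  bdim N (upd (upd l i a) j b) = bdim N (upd (upd l i b) j a).
Proof.
move=> nij; have [K _ E] := bdim_two l nij.
rewrite !E; try by move=> k nki nkj; rewrite !upd_neq.
rewrite !upd_same !(upd_neq _ _ nij) !upd_same natdistC.
congr (_ * _ * _ / _); last exact: mulrC.
by apply: eq_bigr => k _; rewrite mulrC.
Qed.

Lemma bdim_pred_le n N (l : 'I_n -> nat) i : injective l ->
  (\sum_i l i = 'C(n, 2) + N.+1)%N -> (0 < l i)%N ->
  bdim N (upd l i (l i).-1) <= bdim N.+1 l.
Proof.
move=> inj sl gt0; rewrite bdim_rec // (bigD1 i) //= lerDl.
by apply: sumr_ge0 => j _; apply: bdim_ge0.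
Qed.

(** Removing a ribbon does not increase the dimension, because it can be peeled off cell by cell,
    each time with [bdim_pred_le]. *)
Lemma bdim_slide n N d (l : 'I_n -> nat) i t : injective l ->
  (\sum_i l i = 'C(n, 2) + (N + d))%N -> (l i = t + d)%N ->
  bdim N (upd l i t) <= bdim (N + d) l.
Proof.
elim: d N l i t => [|d IHd] N l i t inj sl li.
  rewrite !addn0 in li *; rewrite (@eq_bdim _ _ _ l) // => k.
  by rewrite /upd; case: eqP => [->|].
case: (pickP (fun k => (k != i) && (l k == t))) => [k /andP[nki /eqP lk]|nt].
  by rewrite (@bdim_dup _ _ _ i k) ?bdim_ge0 // 1?eq_sym // upd_same upd_neq.
have {}nt k : l k != t.
  have := nt k; case: eqP => [->|_ /= /negbT //]; lia.
case: (pickP (fun j => l j == (l i).-1)) => [j /eqP lj|np].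
  (* The place below bead [i] is taken by [j]. Send [j] down to [t] first, then lower [i] by one
     into the vacated place; the beads being interchangeable, the outcome is the same. *)
  have nij : i != j.
    by apply/eqP => E; move: lj; rewrite -E; lia.
  have lj' : (l j = t + d)%N by rewrite lj li addnS.
  pose l2 := upd l j t.
  have inj2 : injective l2 by apply: upd_inj.
  have li2 : l2 i = l i by rewrite /l2 upd_neq.
  have sl2 : (\sum_i l2 i = 'C(n, 2) + N.+1)%N.
    have := sum_upd l j t; rewrite -/l2; lia.
  have := @bdim_pred_le _ N l2 i inj2 sl2; rewrite li2 {1}li addnS => /(_ isT) le1.
  have le2 : bdim N.+1 l2 <= bdim (N + d.+1) l by rewrite addnS -addSn IHd // addSnnS.
  apply: le_trans (le_trans le1 le2); rewrite le_eqVlt; apply/orP; left; apply/eqP.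
  transitivity (bdim N (upd (upd l i t) j (l i).-1)).
    apply: eq_bdim => k; rewrite [in RHS]/upd; case: (eqVneq k j) => [->|//].
    by rewrite upd_neq // eq_sym.
  rewrite bdim_swap //; apply: eq_bdim => k; rewrite /l2 /upd.
  case: (eqVneq k j) => [->|//]; case: eqP => // E.
  by rewrite E eqxx in nij.
pose l1 := upd l i (l i).-1.
have inj1 : injective l1 by apply: upd_inj => // k _; apply/negbT/np.
have sl1 : (\sum_i l1 i = 'C(n, 2) + (N + d))%N.
  have := sum_upd l i (l i).-1; rewrite -/l1; lia.
have l1i : (l1 i = t + d)%N by rewrite /l1 upd_same li addnS.
have := IHd N l1 i t inj1 sl1 l1i.
rewrite (@eq_bdim _ N (upd l1 i t) (upd l i t)); last by move=> k; rewrite /l1 /upd; case: eqP.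
move/le_trans; apply; rewrite addnS; apply: bdim_pred_le; rewrite ?li ?addnS //.
by rewrite sl !addnS.
Qed.

Lemma fact_logconvex_bounds N :
  ((N.+1)`! ^ 2 <= N`! * (N.+2)`! <= 2 * (N.+1)`! ^ 2)%N.
Proof.
rewrite !factS; set f := (N`!)%N; rewrite -!mulnn.
apply/andP; split; nia.
Qed.

Lemma natdist_ge0 a b : 0 <= natdist a b. Proof. exact: normr_ge0. Qed.

(** With d >= 1 the distance from x+1 to a, the left side is d^2 - 1. *)
Lemma natdist_mid x a : a != x.+1 -> natdist x a * natdist x.+2 a <= natdist x.+1 a ^+ 2.
Proof.
move=> n; rewrite /natdist -normrM real_normK ?num_real // ler_norml.
have : (a%:R = x%:R + 2%:R :> rat) \/ (a%:R = x%:R :> rat) \/ (1 <= (a%:R - x%:R - 1) ^+ 2 :> rat).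
  case: (ltngtP a x.+1) n => // lt _.
    right; right; have : a%:R <= x%:R :> rat by rewrite ler_nat.
    by nra.
  right; right; have : x%:R + 2 <= a%:R :> rat by rewrite -natrD ler_nat addn2.
  by nra.
rewrite -!(natr1 x.+1) -(natr1 x).
by move=> [->|[->|h]]; apply/andP; split; nra.
Qed.

(** Two cells at the end of one row. Distances and bead factorials are favourable; only N! (N+2)!
    against (N+1)!^2 loses a factor, at most 2. The constant 4 is common to all three shapes of a
    pair of cells. *)
Lemma bdim_two_step_row n N (l : 'I_n -> nat) i x : l i = x.+2 ->
  (forall k, l k != x.+1) ->
  bdim N (upd l i x) * bdim N.+2 l <= 4 * bdim N.+1 (upd l i x.+1) ^+ 2.
Proof.
move=> li nx; have [K K0 E] := bdim_one l i.
rewrite (E N) ?(E N.+2) ?(E N.+1); try by move=> k nki; rewrite ?upd_neq.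
rewrite !upd_same li.
set P0 := \prod_(k | _) _; set P2 := \prod_(k | _) _; set P1 := \prod_(k | _) _.
have P0ge : 0 <= P0 by apply: prodr_ge0 => *; exact: natdist_ge0.
have P2ge : 0 <= P2 by apply: prodr_ge0 => *; exact: natdist_ge0.
have P1ge : 0 <= P1 by apply: prodr_ge0 => *; exact: natdist_ge0.
have leP : P0 * P2 <= P1 ^+ 2.
  rewrite -prodrXl -big_split /=; apply: ler_prod => k nki.
  by rewrite mulr_ge0 ?natdist_ge0 //= natdist_mid.
have /andP[_] := fact_logconvex_bounds N; rewrite -(ler_nat rat) 2!natrM natrX.
have /andP[] := fact_logconvex_bounds x; rewrite -(ler_nat rat) natrM natrX => hx _.
set A0 := N`!%:R; set A1 := (N.+1)`!%:R; set A2 := (N.+2)`!%:R => hA.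
move: hx; set B0 := x`!%:R; set B1 := (x.+1)`!%:R; set B2 := (x.+2)`!%:R => hx.
have B0gt : 0 < B0 :> rat by rewrite ltr0n fact_gt0.
have B1gt : 0 < B1 :> rat by rewrite ltr0n fact_gt0.
have B2gt : 0 < B2 :> rat by rewrite ltr0n fact_gt0.
have A0ge : 0 <= A0 * A2 :> rat by rewrite mulr_ge0 ?ler0n.
have -> : A0 * K * P0 / B0 * (A2 * K * P2 / B2) = (A0 * A2) * (P0 * P2) * K ^+ 2 / (B0 * B2).
  by field; rewrite !gt_eqF.
have -> : 4 * (A1 * K * P1 / B1) ^+ 2 = (4 * A1 ^+ 2) * P1 ^+ 2 * K ^+ 2 / B1 ^+ 2.
  by field; rewrite !gt_eqF.
apply: ler_pM.
- by rewrite !mulr_ge0 // ?ler0n ?sqr_ge0.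
- by rewrite invr_ge0 mulr_ge0 // ltW.
- apply: ler_wpM2r; first exact: sqr_ge0.
  apply: ler_pM => //; first by rewrite mulr_ge0.
  apply: (le_trans hA); rewrite ler_wpM2r ?sqr_ge0 // ler_nat //.
- by rewrite lef_pV2 // ?posrE ?exprn_gt0 // mulr_gt0.
Qed.

(** * Removing two cells *)

(** Here d = |x - y| is at least 2, so d^2 <= 2 (d^2 - 1). *)
Lemma natdist_neighbours x y : x != y -> x.+1 != y -> y.+1 != x ->
  natdist x y ^+ 2 <= 2 * (natdist x y.+1 * natdist x.+1 y).
Proof.
move=> nxy nx ny; rewrite /natdist -normrM real_normK ?num_real //.
rewrite -(natr1 x) -(natr1 y) ger0_norm.
  case: (ltngtP x y) nxy => // lt _.
    have : x%:R + 2 <= y%:R :> rat by rewrite -natrD ler_nat; lia.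
    by nra.
  have : y%:R + 2 <= x%:R :> rat by rewrite -natrD ler_nat; lia.
  by nra.
case: (ltngtP x y) nxy => // lt _.
  have : x%:R + 2 <= y%:R :> rat by rewrite -natrD ler_nat; lia.
  by nra.
have : y%:R + 2 <= x%:R :> rat by rewrite -natrD ler_nat; lia.
by nra.
Qed.

(** Two independent corners. The other beads and the bead factorials cancel exactly; one factor 2
    comes from the factorials of N, the other from the mutual distance of the two beads. *)
Lemma bdim_two_step_corners n N (l : 'I_n -> nat) i j x y : i != j ->
  l i = x.+1 -> l j = y.+1 -> x != y -> x.+1 != y -> y.+1 != x ->
  bdim N (upd (upd l i x) j y) * bdim N.+2 l <=
  4 * (bdim N.+1 (upd l i x) * bdim N.+1 (upd l j y)).
Proof.
move=> nij li lj nxy nx ny; have [K K0 E] := bdim_two l nij.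
rewrite (E N) ?(E N.+2) ?(E N.+1); try by move=> k nki nkj; rewrite ?upd_neq.
have nji : j != i by rewrite eq_sym.
rewrite !(upd_same, upd_neq _ _ nij, upd_neq _ _ nji) li lj.
rewrite !big_split /=.
set Px := \prod_(k | _) natdist x _; set Px1 := \prod_(k | _) natdist x.+1 _.
set Py := \prod_(k | _) natdist y _; set Py1 := \prod_(k | _) natdist y.+1 _.
have P_ge0 (z : nat) : 0 <= \prod_(k | (k != i) && (k != j)) natdist z (l k).
  by apply: prodr_ge0 => *; exact: natdist_ge0.
have /andP[_] := fact_logconvex_bounds N; rewrite -(ler_nat rat) 2!natrM natrX.
set A0 := N`!%:R; set A1 := (N.+1)`!%:R; set A2 := (N.+2)`!%:R => hA.
set Q := K ^+ 2 * (Px * Py * Px1 * Py1) /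
         (x`!%:R * y`!%:R * (x.+1)`!%:R * (y.+1)`!%:R).
have Q_ge0 : 0 <= Q.
  by rewrite !mulr_ge0 ?invr_ge0 ?mulr_ge0 ?sqr_ge0 ?P_ge0.
have f_neq0 z : z`!%:R != 0 :> rat by rewrite pnatr_eq0 -lt0n fact_gt0.
have dS : natdist x.+1 y.+1 = natdist x y.
  by rewrite /natdist -(natr1 x) -(natr1 y) opprD addrACA subrr addr0.
rewrite dS [X in X <= _](_ : _ = (A0 * A2) * natdist x y ^+ 2 * Q); last first.
  by rewrite /Q; field; rewrite !f_neq0.
rewrite [X in _ <= X](_ : _ = (2 * A1 ^+ 2) *
   (2 * (natdist x y.+1 * natdist x.+1 y)) * Q); last first.
  by rewrite /Q; field; rewrite !f_neq0.
apply: ler_wpM2r => //; apply: ler_pM => //; last exact: natdist_neighbours.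
  by rewrite mulr_ge0 ?ler0n.
exact: sqr_ge0.
Qed.

(* The product telescopes: prod_(2 <= t < M) t^2/(t^2-1) = 2 (M-1)/M. *)
Lemma prod_sq_ratio_inj (I : finType) (P : pred I) (f : I -> nat) M :
  {in P &, injective f} -> (forall k, P k -> (2 <= f k < M.+2)%N) ->
  \prod_(k | P k) ((f k)%:R ^+ 2 / ((f k)%:R ^+ 2 - 1)) <= 2 - 2 / M.+2%:R :> rat.
Proof.
elim: M P => [|M IHM] P inj bnd.
  rewrite big_pred0; first by lra.
  by move=> k; apply/negP => /bnd; lia.
have M0 : 0 <= M%:R :> rat by rewrite ler0n.
have {IHM} bound (Q : pred I) : {subset Q <= P} ->
    (forall k, Q k -> f k != M.+2) ->
    \prod_(k | Q k) ((f k)%:R ^+ 2 / ((f k)%:R ^+ 2 - 1)) <= 2 - 2 / M.+2%:R :> rat.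
  move=> sQP nQ; apply: IHM => [a b Qa Qb|k Qk]; first by apply: inj; exact: sQP.
  by have := bnd k (sQP _ Qk); have := nQ k Qk; lia.
have cmp : 2 - 2 / M.+2%:R <= 2 - 2 / M.+3%:R :> rat.
  by rewrite lerD2l lerN2 ler_pM2l // lef_pV2 ?posrE ?ltr0n // ler_nat.
case: (pickP (fun k => P k && (f k == M.+2))) => [k0 /andP[Pk0 /eqP fk0]|none].
  rewrite (bigD1 k0) //= fk0.
  have := bound (fun k => P k && (k != k0)) _ _; set R := \prod_(k | _) _.
  move=> /(_ _ _) /= hR.
  have {}hR : R <= 2 - 2 / M.+2%:R.
    apply: hR => [k /andP[] //|k /andP[Pk]]; apply: contra => /eqP E.
    by apply/eqP/inj => //; rewrite E.
  apply: le_trans (ler_wpM2l _ hR) _.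
    rewrite -(natr1 M.+1) -(natr1 M) divr_ge0 ?sqr_ge0 //; nra.
  rewrite -(natr1 M.+2) -(natr1 M.+1) -(natr1 M) le_eqVlt; apply/orP; left.
  by apply/eqP; field; rewrite !gt_eqF //; nra.
apply: le_trans cmp; apply: bound => // k Pk.
by have := none k; rewrite Pk /= => /negbT.
Qed.

Lemma prod_sq_ratio_inj_le2 (I : finType) (P : pred I) (f : I -> nat) :
  {in P &, injective f} -> (forall k, P k -> (2 <= f k)%N) ->
  \prod_(k | P k) ((f k)%:R ^+ 2 / ((f k)%:R ^+ 2 - 1)) <= 2 :> rat.
Proof.
move=> inj ge2; pose M := (\max_k f k)%N.
apply: le_trans (prod_sq_ratio_inj (M := M) inj _) _; last first.
  by rewrite gerBl divr_ge0 ?ler0n.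
by move=> k Pk; rewrite ge2 //= ltnS leqW // leq_bigmax.
Qed.

(** A converse of [natdist_mid] for whole products. On each side of y+1 the distances are distinct
    and at least 2, so each side loses at most a factor 2. *)
Lemma prod_natdist_mid_le n (P : pred 'I_n) (l : 'I_n -> nat) y : injective l ->
  (forall k, P k -> (l k != y) && (l k != y.+1) && (l k != y.+2)) ->
  (\prod_(k | P k) natdist y.+1 (l k)) ^+ 2 <=
  4 * ((\prod_(k | P k) natdist y.+2 (l k)) * \prod_(k | P k) natdist y (l k)).
Proof.
move=> inj nP; pose d k := (if (l k < y.+1)%N then y.+1 - l k else l k - y.+1)%N.
have d_ge2 k : P k -> (2 <= d k)%N by move=> /nP; rewrite /d; case: ifP; lia.
have dE k : natdist y.+1 (l k) = (d k)%:R.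
  rewrite /d /natdist; case: ltnP => [lt|le].
    by rewrite natrB 1?ltnW // ger0_norm // subr_ge0 ler_nat ltnW.
  by rewrite natrB // distrC ger0_norm // subr_ge0 ler_nat.
have dE2 k : P k -> natdist y.+2 (l k) * natdist y (l k) = (d k)%:R ^+ 2 - 1.
  move=> Pk; rewrite -dE /natdist -normrM real_normK ?num_real //.
  have := d_ge2 k Pk; rewrite -(ler_nat rat) -dE /natdist.
  rewrite -(natr1 y.+1) -(natr1 y) => h; rewrite ger0_norm; first by ring.
  have := h; rewrite -ler_sqr ?nnegrE // real_normK ?num_real //; nra.
have ratio_ge0 k : P k -> 0 <= (d k)%:R ^+ 2 - 1 :> rat.
  by move=> /d_ge2; rewrite -(ler_nat rat); nra.
rewrite -prodrXl -big_split /=.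
rewrite [X in _ <= _ * X](eq_bigr _ dE2).
rewrite (eq_bigr (fun k => (d k)%:R ^+ 2 / ((d k)%:R ^+ 2 - 1) * ((d k)%:R ^+ 2 - 1))); last first.
  move=> k Pk; rewrite dE divfK // gt_eqF //.
  by have := d_ge2 k Pk; rewrite -(ler_nat rat); nra.
rewrite big_split /=; apply: ler_wpM2r; first exact: prodr_ge0.
rewrite (bigID (fun k => (l k < y.+1)%N)) /= (_ : 4 = 2 * 2); last by ring.
apply: ler_pM.
- by apply: prodr_ge0 => k /andP[Pk _]; rewrite divr_ge0 ?sqr_ge0 ?ratio_ge0.
- by apply: prodr_ge0 => k /andP[Pk _]; rewrite divr_ge0 ?sqr_ge0 ?ratio_ge0.
- apply: prod_sq_ratio_inj_le2 => [a b /andP[_ la] /andP[_ lb]|k /andP[Pk _]]; last exact: d_ge2.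
  by rewrite /d la lb => E; apply: inj; lia.
- apply: prod_sq_ratio_inj_le2 => [a b /andP[_ la] /andP[_ lb]|k /andP[Pk _]]; last exact: d_ge2.
  by rewrite /d (negPf la) (negPf lb) => E; apply: inj; lia.
Qed.

(** Two cells in one column. The losses are 2 from the factorials of N, 4 from [prod_natdist_mid_le]
    and 2 from the bead factorials. The middle configuration has its two beads at distance 2, and
    the square of this distance pays back a factor 4. *)
Lemma bdim_two_step_col n N (l : 'I_n -> nat) i j y : injective l ->
  l i = y.+2 -> l j = y.+1 -> (forall k, l k != y) ->
  bdim N (upd (upd l i y.+1) j y) * bdim N.+2 l <=
  4 * bdim N.+1 (upd l j y) ^+ 2.
Proof.
move=> inj li lj ny.
have nij : i != j by apply/eqP => E; move: li; rewrite E lj; lia.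
have [K K0 E] := bdim_two l nij.
rewrite (E N) ?(E N.+2) ?(E N.+1); try by move=> k nki nkj; rewrite ?upd_neq.
rewrite !(upd_same, upd_neq _ _ nij) li lj.
rewrite !big_split /=.
set P0 := \prod_(k | _) natdist y _; set P1 := \prod_(k | _) natdist y.+1 _.
set P2 := \prod_(k | _) natdist y.+2 _.
have P_ge0 (z : nat) : 0 <= \prod_(k | (k != i) && (k != j)) natdist z (l k).
  by apply: prodr_ge0 => *; exact: natdist_ge0.
have hP : P1 ^+ 2 <= 4 * (P2 * P0).
  apply: prod_natdist_mid_le => // k /andP[nki nkj]; rewrite ny /=.
  by rewrite -li -lj !(inj_eq inj) nki nkj.
have /andP[_] := fact_logconvex_bounds N; rewrite -(ler_nat rat) 2!natrM natrX.
have /andP[_] := fact_logconvex_bounds y; rewrite -(ler_nat rat) 2!natrM natrX => hy.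
set A0 := N`!%:R; set A1 := (N.+1)`!%:R; set A2 := (N.+2)`!%:R => hA.
move: hy; set B0 := y`!%:R; set B1 := (y.+1)`!%:R; set B2 := (y.+2)`!%:R => hB.
have B0gt : 0 < B0 :> rat by rewrite ltr0n fact_gt0.
have B1gt : 0 < B1 :> rat by rewrite ltr0n fact_gt0.
have B2gt : 0 < B2 :> rat by rewrite ltr0n fact_gt0.
have -> : natdist y.+1 y = 1 by rewrite /natdist -natrB // subSnn normr1.
have -> : natdist y.+2 y.+1 = 1 by rewrite /natdist -natrB // subSnn normr1.
have -> : natdist y.+2 y = 2.
  by rewrite /natdist -natrB 1?ltnW // -addn2 addKn ger0_norm.
set Q := K ^+ 2 * (P2 * P0) / (B2 * B0).
have Q_ge0 : 0 <= Q.
  by rewrite /Q !mulr_ge0 ?invr_ge0 ?mulr_ge0 ?P_ge0 // ltW.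
rewrite [X in X <= _](_ : _ = (A0 * A2) * (P1 ^+ 2) * Q / B1 ^+ 2); last first.
  by rewrite /Q; field; rewrite !gt_eqF.
rewrite [X in _ <= X](_ : _ = (2 * A1 ^+ 2) * (4 * (P2 * P0)) * Q * (2 / (B0 * B2))); last first.
  by rewrite /Q; field; rewrite !gt_eqF.
apply: ler_pM.
- apply: mulr_ge0 => //; apply: mulr_ge0; last exact: sqr_ge0.
  by rewrite mulr_ge0 ?ler0n.
- by rewrite invr_ge0 sqr_ge0.
- apply: ler_wpM2r => //; apply: ler_pM => //; last exact: sqr_ge0.
  by rewrite mulr_ge0 ?ler0n.
- by rewrite ler_pdivlMr ?mulr_gt0 // mulrC ler_pdivrMr ?exprn_gt0.
Qed.

(** * Removing a ribbon *)

Lemma upd_swap n (l : 'I_n -> nat) i j a b : i != j ->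
  upd (upd l i a) j b =1 upd (upd l j b) i a.
Proof.
move=> nij k; rewrite /upd; case: (eqVneq k j) => [->|//].
by rewrite eq_sym (negPf nij).
Qed.

Lemma upd_upd n (l : 'I_n -> nat) i a b : upd (upd l i a) i b =1 upd l i b.
Proof. by move=> k; rewrite /upd; case: eqP. Qed.

Lemma upd_id n (l : 'I_n -> nat) i : upd l i (l i) =1 l.
Proof. by move=> k; rewrite /upd; case: eqP => [->|]. Qed.

Lemma eq_upd n (l l' : 'I_n -> nat) i t : l =1 l' -> upd l i t =1 upd l' i t.
Proof. by move=> E k; rewrite /upd E. Qed.

(* Moving bead i to t is moving bead h to t followed by moving bead i to the place of h. *)
Lemma bdim_upd_le n N (l : 'I_n -> nat) i h t : injective l ->
  (forall k, l k != t) -> (t < l h)%N -> (l h <= l i)%N ->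
  (\sum_i l i = 'C(n, 2) + (N + (l i - t)))%N ->
  bdim N (upd l i t) <= bdim (N + (l i - l h)) (upd l h t).
Proof.
move=> inj nt lt le sl; case: (eqVneq i h) => [E|nih].
  by rewrite E subnn addn0.
have -> : bdim N (upd l i t) = bdim N (upd (upd l h t) i (l h)).
  rewrite -[RHS](eq_bdim N (upd_swap l (l h) t nih)).
  rewrite bdim_swap //; apply: eq_bdim => k.
  by rewrite upd_swap // (eq_upd _ _ (upd_id l h)).
apply: bdim_slide; first by apply: upd_inj.
  by have := sum_upd l h t; lia.
by rewrite upd_neq // subnKC.
Qed.

(** The beads above [l i - r] and up to [l i] mark the rows of the ribbon. Two of its cells are
    removed under control of the two-step bounds; the remaining ones are removed by slides, which do
    not increase the dimension. *)
Lemma bdim_ribbon_le n N r (l : 'I_n -> nat) i : injective l ->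
  (\sum_i l i = 'C(n, 2) + (N + r))%N -> (2 <= r)%N -> (r <= l i)%N ->
  bdim N (upd l i (l i - r)) * bdim (N + r) l <=
  4 * (\sum_(j | (l i - r < l j <= l i)%N) bdim (N + r).-1 (upd l j (l j).-1)) ^+ 2.
Proof.
move=> inj sl r2 rle; set t := (l i - r)%N; set S := \sum_(j | _) _.
have S_ge0 : 0 <= S by apply: sumr_ge0 => *; exact: bdim_ge0.
(* If [t] is occupied there is no ribbon to remove, and the left side is 0. *)
case: (pickP (fun k => l k == t)) => [k /eqP lk|nt].
  rewrite (@bdim_dup _ _ _ i k) ?mul0r ?mulr_ge0 ?sqr_ge0 //.
    by apply/eqP => E; move: lk; rewrite -E /t; lia.
  rewrite upd_same upd_neq //; apply/eqP => E; move: lk; rewrite E /t; lia.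
have {}nt k : l k != t by apply/negbT/nt.
have p_le j : (t < l j <= l i)%N -> bdim (N + r).-1 (upd l j (l j).-1) <= S.
  move=> Pj; rewrite /S (bigD1 j) //= lerDl.
  by apply: sumr_ge0 => *; exact: bdim_ge0.
have b_ge0 := bdim_ge0.
have [M Nr] : exists M, (N + r = M.+2)%N by exists (N + r - 2)%N; lia.
have Pi : (t < l i <= l i)%N by rewrite /t; lia.
(* The two lowest beads j and h above t can each be lowered by one, in this order. *)
case: (@arg_minnP _ i (fun j => (t < l j <= l i)%N) l Pi) => j Pj minj.
(* If [i] is the only bead in the window, the ribbon lies in one row and its last two cells are
   taken. *)
case: (eqVneq j i) => [E|nji].
  subst j; pose x := (l i - 2)%N.
  have lx : l i = x.+2 by rewrite /x; lia.
  have nx1 k : l k != x.+1.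
    by apply/eqP => E; have := minj k; rewrite /x /t in E *; lia.
  have nx k : l k != x.
    apply/eqP => E; case: (eqVneq x t) => [xt|nxt].
      by have := nt k; rewrite E xt eqxx.
    by have := minj k; rewrite /x /t in E nxt *; lia.
  have := bdim_two_step_row M lx nx1; rewrite -Nr => step.
  have le1 : bdim N (upd l i t) <= bdim M (upd l i x).
    rewrite -(eq_bdim N (upd_upd l i x t)).
    rewrite (_ : (M = N + (x - t))%N); last by rewrite /x /t; lia.
    apply: bdim_slide; first exact: upd_inj.
      by have := sum_upd l i x; rewrite /t /x; lia.
    by rewrite upd_same /x /t; lia.
  apply: le_trans (ler_wpM2r (b_ge0 _ _ _) le1) _; apply: le_trans step _.
  rewrite ler_pM2l // lerXn2r ?nnegrE //.
  by have := p_le i Pi; rewrite Nr lx.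
have Pij : (t < l i <= l i)%N && (i != j) by rewrite Pi eq_sym.
case: (@arg_minnP _ i (fun h => (t < l h <= l i)%N && (h != j)) l Pij) => h.
move=> /andP[Ph nhj] minh.
have nlhj : l h != l j by rewrite (inj_eq inj).
have jh : (l j < l h)%N by have := minj h Ph; lia.
pose y := (l j).-1; pose z := (l h).-1.
have lj : l j = y.+1 by rewrite /y; lia.
have lh : l h = z.+1 by rewrite /z; lia.
have ny k : l k != y.
  apply/eqP => E; case: (eqVneq y t) => [yt|nyt].
    by have := nt k; rewrite E yt eqxx.
  by have := minj k; rewrite /y in E nyt *; lia.
have nz k : k != j -> l k != z.
  move=> nkj; apply/eqP => E; have := minh k; rewrite nkj /z in E *.
  by lia.
pose l2 := upd (upd l h z) j y.
have inj2 : injective l2.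
  have njh : j != h by rewrite eq_sym.
  have injl : injective (upd l j y) by apply: upd_inj.
  have inj' : injective (upd (upd l j y) h z).
    apply: upd_inj => // k nkh; rewrite /upd; case: (eqVneq k j) => [_|nkj]; last exact: nz.
    by rewrite /y /z; lia.
  by move=> a b E; apply: inj'; move: E; rewrite /l2 !(upd_swap _ _ _ nhj).
have tj : (t <= y)%N by rewrite /y; lia.
(* Up to relabelling beads, the ribbon removal is reached from [l2] by three slides: [j] from [y] to
   [t], [h] from [z] to the old place of [j], and [i] to the old place of [h]. *)
have le1 : bdim N (upd l i t) <= bdim M l2.
  apply: le_trans (bdim_upd_le (h := h) _ _ _ _ _) _ => //; [lia|lia| |].
    by rewrite sl /t; lia.
  have -> : bdim (N + (l i - l h)) (upd l h t) =
            bdim (N + (l i - l h)) (upd (upd l2 j t) h (l j)).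
    transitivity (bdim (N + (l i - l h)) (upd (upd l h t) j (l j))).
      apply: eq_bdim => k; rewrite [in RHS]/upd; case: (eqVneq k j) => [->|//].
      by rewrite upd_neq // eq_sym.
    rewrite bdim_swap //; apply: eq_bdim => k.
    rewrite /l2 /upd; case: (eqVneq k j) => [->|nkj]; last by case: (eqVneq k h).
    by rewrite eq_sym (negPf nhj).
  have sl2 : (\sum_k l2 k + 2 = \sum_k l k)%N.
    have := sum_upd (upd l h z) j y; have := sum_upd l h z.
    rewrite -/l2 (upd_neq _ _ (_ : j != h)) 1?eq_sym //; lia.
  have inj3 : injective (upd l2 j t).
    apply: upd_inj => // k nkj; rewrite /l2 upd_neq // /upd.
    by case: (eqVneq k h) => // _; apply/eqP; lia.
  have l2j : l2 j = y by rewrite /l2 upd_same.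
  have l2h : l2 h = z by rewrite /l2 upd_neq // upd_same.
  have sl3 := sum_upd l2 j t; rewrite l2j in sl3.
  apply: (@le_trans _ _ (bdim (N + (l i - l h) + (z - l j)) (upd l2 j t))).
    apply: bdim_slide => //; first by rewrite /t in sl3 tj *; lia.
    by rewrite upd_neq // l2h; lia.
  rewrite (_ : (M = N + (l i - l h) + (z - l j) + (y - t))%N); last first.
    by rewrite /t; lia.
  apply: bdim_slide => //; rewrite ?l2j; last by rewrite subnKC.
  by rewrite /t in tj *; lia.
apply: le_trans (ler_wpM2r (b_ge0 _ _ _) le1) _.
have pj : bdim M.+1 (upd l j y) <= S by have := p_le j Pj; rewrite Nr.
have ph : bdim M.+1 (upd l h z) <= S by have := p_le h Ph; rewrite Nr.
rewrite [in bdim (N + r) l]Nr.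
(* If [h] sits directly above [j], the two cells form a column; otherwise they are independent
   corners. *)
case: (eqVneq z (l j)) => [E|nzj].
  have lh' : l h = y.+2 by lia.
  apply: le_trans (_ : _ <= 4 * bdim M.+1 (upd l j y) ^+ 2) _; last first.
    by rewrite ler_pM2l // lerXn2r ?nnegrE.
  rewrite /l2 (_ : z = y.+1); last by lia.
  exact: bdim_two_step_col.
apply: le_trans (bdim_two_step_corners (i := h) (j := j) _ _ lh lj _ _ _) _ => //; try lia.
by rewrite ler_pM2l // expr2 ler_pM.
Qed.

(** This sums a_i sqrt f <= s_i sqrt c over i without leaving the rationals: after expanding both
    squares, the products a_i a_j f and c s_i s_j are compared through their squares. *)
Lemma sum_sq_bound (I : finType) (P : pred I) (a s : I -> rat) (f c : rat) :
  0 <= f -> 0 <= c -> (forall i, P i -> 0 <= a i) -> (forall i, P i -> 0 <= s i) ->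
  (forall i, P i -> a i ^+ 2 * f <= c * s i ^+ 2) ->
  (\sum_(i | P i) a i) ^+ 2 * f <= c * (\sum_(i | P i) s i) ^+ 2.
Proof.
move=> f0 c0 a0 s0 h.
rewrite !expr2 !big_distrlr /= mulr_suml mulr_sumr; apply: ler_sum => i Pi.
rewrite mulr_suml mulr_sumr; apply: ler_sum => j Pj.
rewrite -ler_sqr ?nnegrE ?mulr_ge0 ?a0 ?s0 //.
rewrite (_ : (a i * a j * f) ^+ 2 = (a i ^+ 2 * f) * (a j ^+ 2 * f)); last by ring.
rewrite (_ : (c * (s i * s j)) ^+ 2 = (c * s i ^+ 2) * (c * s j ^+ 2)); last by ring.
by apply: ler_pM; first [exact: h | exact: (mulr_ge0 (sqr_ge0 _) f0)].
Qed.

(** The positions [l i] are distinct and lie among the r consecutive integers starting at [l j]. *)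
Lemma card_window n r (l : 'I_n -> nat) j : injective l ->
  (#|[pred i | (l i - r < l j)%N && (l j <= l i)%N & (r <= l i)%N]| <= r)%N.
Proof.
move=> inj; rewrite -[X in (_ <= X)%N](size_iota (l j)) cardE.
rewrite -(size_map l); apply: uniq_leq_size; first by rewrite map_inj_uniq ?enum_uniq.
move=> x /mapP[i]; rewrite mem_enum inE => h ->; rewrite mem_iota.
by move: h; lia.
Qed.

(** The bound 2 r sqrt f for the sum of the square roots over all ribbons, in rational form: a_i
    stands for a character value of size at most the square root of K times the dimension left after
    the ribbon. *)
Lemma ribbon_sum_bound n N r (l : 'I_n -> nat) (a : 'I_n -> rat) (K : rat) :
  injective l -> (\sum_i l i = 'C(n, 2) + (N + r))%N -> (2 <= r)%N -> 0 <= K ->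
  (forall i, (r <= l i)%N -> 0 <= a i) ->
  (forall i, (r <= l i)%N -> a i ^+ 2 <= K * bdim N (upd l i (l i - r))) ->
  (\sum_(i | (r <= l i)%N) a i) ^+ 2 <= K * (2 * r)%:R ^+ 2 * bdim (N + r) l.
Proof.
move=> inj sl r2 K0 a0 ha; set f := bdim (N + r) l.
have f0 : 0 < f by exact: bdim_gt0.
pose p j := bdim (N + r).-1 (upd l j (l j).-1).
have p0 j : 0 <= p j by exact: bdim_ge0.
pose s i := \sum_(j | (l i - r < l j <= l i)%N) p j.
have s0 i : 0 <= s i by apply: sumr_ge0.
have sum_p : f = \sum_(j | (0 < l j)%N) p j.
  by rewrite /f (_ : (N + r = (N + r).-1.+1)%N) ?bdim_rec //; lia.
have sum_s : \sum_(i | (r <= l i)%N) s i <= r%:R * f.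
  rewrite sum_p mulr_sumr (exchange_big_dep (fun j => (0 < l j)%N)) /=; last by move=> i j; lia.
  apply: ler_sum => j _; rewrite sumr_const -[p j *+ _]mulr_natl ler_wpM2r // ler_nat.
  apply: leq_trans (card_window r j inj).
  by apply: subset_leq_card; apply/subsetP => i; rewrite !inE; lia.
have step := sum_sq_bound (f := f) (c := 4 * K) (ltW f0) _ a0 (fun i _ => s0 i) _.
have : (\sum_(i | (r <= l i)%N) a i) ^+ 2 * f <= 4 * K * (r%:R * f) ^+ 2.
  apply: le_trans (step _ _) _; first by rewrite mulr_ge0.
    move=> i ri; apply: le_trans (ler_wpM2r (ltW f0) (ha i ri)) _.
    rewrite (_ : 4 * K * s i ^+ 2 = K * (4 * s i ^+ 2)); last by ring.
    rewrite -mulrA ler_wpM2l //.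
    exact: bdim_ribbon_le.
  apply: ler_wpM2l; first by rewrite mulr_ge0.
  by rewrite lerXn2r ?nnegrE ?mulr_ge0 ?ler0n ?sumr_ge0 // ltW.
move=> h; rewrite -(ler_pM2r f0) natrM; apply: le_trans h _.
by rewrite le_eqVlt; apply/orP; left; apply/eqP; ring.
Qed.

(** * A lower bound by hook lengths *)

(** Both sides run once over the unordered pairs. The operation is general because it is used for a
    product of distances and for a count of pairs. *)
Lemma big_pairs_reorder (R : Type) (idx : R) (op : Monoid.com_law idx) n
    (l : 'I_n -> nat) (h : 'I_n -> 'I_n -> R) :
  injective l -> (forall a b, h a b = h b a) ->
  \big[op/idx]_(i < n) \big[op/idx]_(j | (l j < l i)%N) h i j =
  \big[op/idx]_(i < n) \big[op/idx]_(j < n | (i < j)%N) h i j.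
Proof.
move=> inj hC.
have split_ord i : \big[op/idx]_(j | (l j < l i)%N) h i j =
  op (\big[op/idx]_(j < n | (l j < l i)%N && (i < j)%N) h i j)
     (\big[op/idx]_(j < n | (l j < l i)%N && (j < i)%N) h i j).
  rewrite (bigID (fun j : 'I_n => (i < j)%N)) /=; congr (op _ _).
  apply: eq_bigl => j; case: (ltngtP i j) => // /ord_inj ->.
  by rewrite ltnn.
rewrite (eq_bigr _ (fun i _ => split_ord i)) big_split /=.
rewrite (exchange_big_dep xpredT (F := h) (P := xpredT)
  (Q := fun i j : 'I_n => (l j < l i)%N && (j < i)%N)) //= -big_split /=.
apply: eq_bigr => i _; rewrite [RHS](bigID (fun j => (l j < l i)%N)) /=.
congr (op _ _); first by apply: eq_bigl => j; rewrite andbC.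
rewrite (eq_bigr (fun j => h i j)) //; apply: eq_bigl => j.
case: (ltngtP (l i) (l j)) => [_|_|/inj ->]; rewrite ?andbT ?andbF //.
by rewrite ltnn.
Qed.

(** Positions are split into beads and gaps. The gaps below a bead correspond to the cells of its
    row, and the distances to them are the hook lengths. *)
Lemma big_split_image (R : Type) (idx : R) (op : Monoid.com_law idx) n
    (l : 'I_n -> nat) (F : nat -> R) m : injective l ->
  \big[op/idx]_(y < m) F y =
  op (\big[op/idx]_(j | (l j < m)%N) F (l j))
     (\big[op/idx]_(y < m | (y : nat) \notin codom l) F y).
Proof.
move=> inj; rewrite (bigID (fun y : 'I_m => (y : nat) \in codom l)) /=; congr (op _ _).
rewrite -(big_mkord (fun y => y \in codom l) F) -big_filter.
rewrite -[RHS]big_filter -(big_map l xpredT F).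
apply: perm_big; apply: uniq_perm.
- by rewrite filter_uniq ?iota_uniq.
- by rewrite map_inj_uniq // filter_uniq ?index_enum_uniq.
move=> y; rewrite mem_filter mem_index_iota /=; apply/andP/mapP => [[/codomP[j ->] lt]|[j]].
  by exists j; rewrite // mem_filter lt mem_index_enum.
by rewrite mem_filter => /andP[lt _] ->; rewrite codom_f.
Qed.

Lemma sum_card_pairs n (l : 'I_n -> nat) : injective l ->
  (\sum_(i < n) \sum_(j < n | l j < l i) 1 = 'C(n, 2))%N.
Proof.
move=> inj; rewrite (big_pairs_reorder addn) //.
rewrite -(big_pairs_reorder addn (l := val) (h := fun _ _ => 1%N)) //; last exact: val_inj.
rewrite -triangular_sum big_mkord; apply: eq_bigr => i _.
rewrite -(big_ord_widen n (fun=> 1%N)); last exact: (ltnW (ltn_ord i)).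
by rewrite sum1_card card_ord.
Qed.

(* The factors y < l_i of l_i! with y in the image of l cancel the Vandermonde product;
   the remaining ones are the N hook lengths. *)
Lemma bdim_hook_bound n N r c (l : 'I_n -> nat) : injective l ->
  (\sum_i l i = 'C(n, 2) + N)%N -> (forall i, l i < n + r)%N ->
  (forall y, (y + c < n)%N -> y \in codom l) ->
  N`!%:R <= (r + c)%:R ^+ N * bdim N l.
Proof.
move=> inj sl lr lc.
pose H := (\prod_(i < n) \prod_(y < l i | (y : nat) \notin codom l) (l i - y))%N.
pose P := (\prod_(i < n) \prod_(j < n | l j < l i) (l i - l j))%N.
have factE : (\prod_i (l i)`! = P * H)%N.
  rewrite /P /H -big_split /=; apply: eq_bigr => i _.
  by rewrite -ffactnn ffact_prod (big_split_image muln (fun y => l i - y)%N (l i) inj).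
(* There are N factors by [cnt]; each is at most r + c because a gap y satisfies y + c >= n. *)
have Hle : (H <= (r + c) ^ N)%N.
  have cnt : (\sum_(i < n) \sum_(y < l i | (y : nat) \notin codom l) 1 = N)%N.
    apply/(@addnI 'C(n, 2)); rewrite -sl -{1}(sum_card_pairs inj) -big_split /=.
    apply: eq_bigr => i _.
    by rewrite -(big_split_image addn (fun=> 1%N) (l i) inj) sum1_card card_ord.
  rewrite -[X in (_ <= _ ^ X)%N]cnt expn_sum; apply: leq_prod => i _.
  rewrite expn_sum; apply: leq_prod => y ny; rewrite expn1.
  have := lr i; case: (leqP n (y + c)) => [|/lc]; last by rewrite (negPf ny).
  lia.
have Pgt : (0 < P)%N.
  by rewrite prodn_gt0 // => i; rewrite prodn_cond_gt0 // => j; rewrite subn_gt0.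
have Hgt : (0 < H)%N.
  by rewrite prodn_gt0 // => i; rewrite prodn_cond_gt0 // => y _; rewrite subn_gt0.
have PE : pairprod xpredT (fun a b => natdist (l a) (l b)) = P%:R.
  rewrite /P natr_prod /pairprod /=.
  rewrite -(big_pairs_reorder *%R inj) => [|a b]; last exact: natdistC.
  apply: eq_bigr => i _; rewrite natr_prod; apply: eq_bigr => j lt.
  by rewrite natrB 1?ltnW // /natdist ger0_norm // subr_ge0 ler_nat ltnW.
rewrite bdimE PE -natr_prod factE natrM.
have -> : N`!%:R * P%:R / (P%:R * H%:R) = N`!%:R / H%:R :> rat.
  by field; rewrite !pnatr_eq0 -!lt0n Pgt Hgt.
rewrite mulrCA ler_peMr ?ler0n // ler_pdivlMr ?ltr0n // mul1r -natrX ler_nat.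
exact: Hle.
Qed.

(** N^N is at most 2N (2N-1) ... (N+1), which is N! times a binomial coefficient of 2N. *)
Lemma expn_le_fact N : (N ^ N <= 4 ^ N * N`!)%N.
Proof.
have le1 : (N ^ N <= (N + N) ^_ N)%N.
  rewrite ffact_prod -[X in (_ ^ X <= _)%N]card_ord -prod_nat_const.
  by apply: leq_prod => i _; have := ltn_ord i; lia.
apply: leq_trans le1 _; rewrite -bin_ffact leq_mul2r; apply/orP; right.
rewrite (_ : 4 = 2 ^ 2)%N // -expnM mul2n -addnn.
rewrite -[X in (_ <= X ^ _)%N]/(1 + 1)%N expnDn (bigD1 (inord N)) //=.
by rewrite !exp1n !muln1 inordK ?leq_addr // ltnS leq_addr.
Qed.

(** * Coefficients of the Frobenius formula *)

(** Frobenius' coefficient for a list of cycle lengths and arbitrary exponents, so that cycles can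
    be taken off one at a time and beads need not stay sorted. *)
Definition pcoef n (rs : seq nat) (l : 'I_n -> nat) : int :=
  (vandermonde n * \prod_(r <- rs) pow_sum n r)@_[multinom l i | i < n].

Lemma eq_pcoef n rs (l l' : 'I_n -> nat) : l =1 l' -> pcoef rs l = pcoef rs l'.
Proof.
move=> E; rewrite /pcoef; congr (_@_ _); apply/mnmP => i.
by rewrite !mnmE.
Qed.

Lemma mcoeffM_Xpow n (p : {mpoly int[n]}) i r (l : 'I_n -> nat) :
  (p * 'X_i ^+ r)@_[multinom l j | j < n] =
  if (r <= l i)%N then p@_[multinom upd l i (l i - r) j | j < n] else 0.
Proof.
rewrite mpolyXn; case: leqP => [le|lt].
  have -> : [multinom l j | j < n] =
     ((U_(i) *+ r) + [multinom upd l i (l i - r) j | j < n])%MM.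
    apply/mnmP => j; rewrite mnmDE mulmnE mnm1E !mnmE /upd eq_sym.
    by case: eqP => [->|_]; rewrite ?mul1n ?mul0n // subnKC.
  exact: mcoeffMX.
rewrite [p]mpolyE mulr_suml raddf_sum big1 // => m _ /=.
rewrite -scalerAl -mpolyXD mcoeffZ mcoeffX; case: eqP => [E|]; last by rewrite mulr0.
move: lt; have := congr1 (fun x : 'X_{1..n} => x i) E.
rewrite mnmDE mulmnE mnm1E eqxx mul1n mnmE => <-.
by rewrite ltnNge leq_addl.
Qed.

(** The Murnaghan-Nakayama rule on beads. The usual signs do not appear since the beads are not
    sorted again after a move. *)
Lemma pcoef_cons n r rs (l : 'I_n -> nat) :
  pcoef (r :: rs) l = \sum_(i | (r <= l i)%N) pcoef rs (upd l i (l i - r)).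
Proof.
rewrite /pcoef big_cons mulrCA mulrC mulr_sumr raddf_sum [RHS]big_mkcond /=.
by apply: eq_bigr => i _; rewrite mcoeffM_Xpow.
Qed.

(** The sign between [vandermonde], with factors X_i - X_j for i < j, and the Vandermonde
    determinant, with factors X_j - X_i. *)
Definition pairs_sign n : int := \prod_(i < n) \prod_(j < n | (i < j)%N) -1.

Lemma pcoef_nil n (l : 'I_n -> nat) :
  pcoef [::] l = pairs_sign n *
    \sum_(s : {perm 'I_n}) (-1) ^+ s * [forall i, l i == s i]%:R.
Proof.
rewrite /pcoef big_nil mulr1.
have -> : vandermonde n = (pairs_sign n)%:MP *
    \sum_(s : {perm 'I_n}) ((-1) ^+ s)%:MP * \prod_i 'X_i ^+ s i.
  have <- : \det (Vandermonde n (\row_j ('X_j : {mpoly int[n]}))) =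
     \sum_(s : {perm 'I_n}) ((-1) ^+ s)%:MP * \prod_i 'X_i ^+ s i.
    rewrite -det_tr; apply: eq_bigr => s _; rewrite rmorphXn rmorphN rmorph1; congr (_ * _).
    by apply: eq_bigr => i _; rewrite !mxE.
  rewrite det_Vandermonde /pairs_sign rmorph_prod -big_split /=.
  apply: eq_bigr => i _; rewrite rmorph_prod -big_split /=; apply: eq_bigr => j _.
  by rewrite !mxE rmorphN rmorph1 mulN1r opprB.
rewrite mcoeffCM raddf_sum; congr (_ * _); apply: eq_bigr => s _ /=.
rewrite mcoeffCM mprodXnE mcoeffX; congr (_ * (nat_of_bool _)%:R).
apply/eqP/forallP => [E i|E].
  have := congr1 (fun x : 'X_{1..n} => x i) E; rewrite mnmE => <-.
  rewrite mnm_sumE (bigD1 i) //= mulmnE mnm1E eqxx mul1n big1 ?addn0 // => j nji.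
  by rewrite mulmnE mnm1E (negPf nji).
apply/mnmP => i; rewrite mnmE (eqP (E i)).
rewrite mnm_sumE (bigD1 i) //= mulmnE mnm1E eqxx mul1n big1 ?addn0 // => j nji.
by rewrite mulmnE mnm1E (negPf nji).
Qed.

(** The rule [pcoef_cons] is symmetric in the beads, so the alternation of the base case persists.
    It makes every move onto an occupied place contribute 0. *)
Lemma pcoef_tperm n rs (l : 'I_n -> nat) i j : i != j ->
  pcoef rs (l \o tperm i j) = - pcoef rs l.
Proof.
move=> nij; elim: rs l => [|r rs IHrs] l.
  rewrite !pcoef_nil -mulrN; congr (_ * _); rewrite -sumrN.
  rewrite (reindex_inj (mulgI (tperm i j))) /=; apply: eq_bigr => s _.
  rewrite odd_permM odd_tperm nij signr_addb expr1 -!mulNr mulN1r; congr (_ * _%:R).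
  congr nat_of_bool; apply/forallP/forallP => E k.
    by have := E (tperm i j k); rewrite /= permM tpermK.
  by rewrite /= permM.
rewrite !pcoef_cons -sumrN (reindex_inj (h := tperm i j) perm_inj) /=.
apply: eq_big => k; rewrite tpermK // => _; rewrite -IHrs; apply: eq_pcoef => q.
by rewrite /upd /= -(inj_eq (@perm_inj _ (tperm i j))) tpermK.
Qed.

Lemma pcoef_dup n rs (l : 'I_n -> nat) i j : i != j -> l i = l j -> pcoef rs l = 0.
Proof.
move=> nij E; have := pcoef_tperm rs l nij.
rewrite (@eq_pcoef _ rs _ l) => [|k /=]; last by case: tpermP => [->|->|].
by lia.
Qed.

Lemma injective_or_dup n (l : 'I_n -> nat) :
  injective l \/ exists i j, i != j /\ l i = l j.
Proof.
case: (pickP (fun p : 'I_n * 'I_n => (p.1 != p.2) && (l p.1 == l p.2))).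
  by move=> [i j] /andP[nij /eqP E]; right; exists i, j.
move=> none; left=> i j E; apply/eqP/negPn/negP => nij.
by have := none (i, j); rewrite /= nij E eqxx.
Qed.

(** A Leibniz term is nonzero only if l_i >= s(i) for all i, and equality of the sums then forces l
    = s; in that case its product of falling factorials is exactly the product of the l_i!. *)
Lemma sdim0E n (l : 'I_n -> nat) : (\sum_i l i = 'C(n, 2))%N ->
  sdim 0 l = \sum_(s : {perm 'I_n}) (-1) ^+ s * [forall i, l i == s i]%:R.
Proof.
move=> sl; rewrite /sdim fact0 mul1r mulr_suml; apply: eq_bigr => s _.
rewrite -mulrA; congr (_ * _).
have F0 := gt_eqF (prod_fact_gt0 l).
case: forallP => [E|nE].
  apply/eqP; rewrite -(inj_eq (mulIf (negbT F0))) mul1r divfK ?F0 //.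
  by apply/eqP/eq_bigr => i _; rewrite mxE (eqP (E i)) ffactnn.
have [i lt] : exists i, (l i < s i)%N.
  apply/existsP; apply: contraT; rewrite negb_exists => /forallP ge; case: nE.
  have ge' i : (s i <= l i)%N by rewrite leqNgt.
  have sumE : (\sum_i s i = \sum_i l i)%N.
    rewrite sl -(reindex_inj (h := s) (F := fun i : 'I_n => i : nat) (P := xpredT) perm_inj).
    by rewrite -triangular_sum big_mkord.
  have [_] := leqif_sum (fun i (_ : xpredT i) => leqif_eq (ge' i)).
  by rewrite sumE eqxx => /esym/forallP E i; rewrite eq_sym; exact: E.
by rewrite (bigD1 i) //= mxE ffact_small // !mul0r.
Qed.

Lemma pcoef_ones n N (l : 'I_n -> nat) : (\sum_i l i = 'C(n, 2) + N)%N ->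
  (pcoef (nseq N 1%N) l)%:~R = (pairs_sign n)%:~R * sdim N l.
Proof.
elim: N l => [|N IHN] l sl.
  rewrite addn0 in sl; rewrite sdim0E // pcoef_nil rmorphM rmorph_sum /=.
  congr (_ * _); apply: eq_bigr => s _.
  by rewrite rmorphM rmorphXn rmorphN rmorph1 /= mulrz_nat.
rewrite /= pcoef_cons sdim_rec // mulr_sumr rmorph_sum /=; apply: eq_bigr => i gt0.
rewrite subn1 IHN //; have := sum_upd l i (l i).-1; lia.
Qed.

Lemma pcoef_ones_decreasing n N (l : 'I_n -> nat) :
  (\sum_i l i = 'C(n, 2) + N)%N -> (forall i j : 'I_n, (i < j)%N -> (l j < l i)%N) ->
  (pcoef (nseq N 1%N) l)%:~R = bdim N l.
Proof.
move=> sl dec; rewrite pcoef_ones // bdimE /sdim ffdetE mulrA mulrCA.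
congr (_ * _ / _); rewrite /pairs_sign /pairprod rmorph_prod -big_split /=.
apply: eq_bigr => i _; rewrite rmorph_prod -big_split /=; apply: eq_bigr => j ij.
rewrite rmorphN rmorph1 mulN1r opprB /natdist ger0_norm // subr_ge0 ler_nat.
by rewrite ltnW // dec.
Qed.

Lemma pairs_sign_norm n : `|pairs_sign n| = 1.
Proof.
rewrite normr_prod big1 // => i _; rewrite normr_prod big1 // => j _; exact: normrN1.
Qed.

(** For the empty partition the signed dimension is 0, 1 or -1. *)
Lemma sdim0_sq n (l : 'I_n -> nat) : (\sum_i l i = 'C(n, 2))%N ->
  sdim 0 l ^+ 2 = bdim 0 l.
Proof.
move=> sl; rewrite /bdim sdim0E //.
case: (pickP (fun s : {perm 'I_n} => [forall i, l i == s i])) => [s0 Es0|none].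
  rewrite (bigD1 s0) //= Es0 mulr1 big1 ?addr0 ?sqrr_sign ?normr_sign // => s ns.
  case: forallP => [E|]; last by rewrite mulr0.
  case/eqP: ns; apply/permP => i; apply/ord_inj.
  by rewrite -(eqP (E i)) (eqP (forallP Es0 i)).
by rewrite big1 ?expr0n ?normr0 // => s _; rewrite none mulr0.
Qed.

(** Induction on the cycles: [ribbon_sum_bound] is applied to the absolute values left after the
    first cycle, with K = 4^(sum of the other cycles). *)
Lemma pcoef_sq_bound n rs (l : 'I_n -> nat) : all (leq 2) rs ->
  (\sum_i l i = 'C(n, 2) + sumn rs)%N ->
  (pcoef rs l)%:~R ^+ 2 <= 4 ^+ (sumn rs) * bdim (sumn rs) l.
Proof.
elim: rs l => [|r rs IHrs] l /= => [_ sl|/andP[r2 rs2] sl].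
  rewrite expr0 mul1r -sdim0_sq; last by rewrite sl addn0.
  rewrite (@pcoef_ones _ 0) // exprMn -rmorphXn /=.
  by rewrite -[pairs_sign n ^+ 2]real_normK ?num_real // pairs_sign_norm expr1n mul1r.
case: (injective_or_dup l) => [inj|[i [j [nij E]]]]; last first.
  by rewrite (pcoef_dup _ nij E) expr0n mulr_ge0 ?exprn_ge0 ?bdim_ge0.
rewrite pcoef_cons rmorph_sum /=.
pose a i : rat := (pcoef rs (upd l i (l i - r)))%:~R.
have sumr i : (r <= l i)%N ->
    (\sum_k upd l i (l i - r) k = 'C(n, 2) + sumn rs)%N.
  by move=> ri; apply: sum_upd_sub ri _; rewrite sl addnA addnAC.
have := @ribbon_sum_bound n (sumn rs) r l (fun i => `|a i|) (4 ^+ sumn rs) inj.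
rewrite sl [(sumn rs + r)%N]addnC => /(_ erefl r2) bound.
apply: le_trans (_ : _ <= (\sum_(i | (r <= l i)%N) `|a i|) ^+ 2) _.
  by rewrite -real_normK ?num_real // lerXn2r ?nnegrE ?sumr_ge0 ?ler_norm_sum.
apply: le_trans (bound _ _ _) _ => //; first by rewrite exprn_ge0.
  by move=> i ri; rewrite real_normK ?num_real // IHrs // sumr.
(* What remains is (2r)^2 <= 4^r, that is 2r <= 2^r, which holds for r >= 2. *)
rewrite exprD ler_wpM2r ?bdim_ge0 // mulrC ler_wpM2r ?exprn_ge0 //.
rewrite (_ : 4 = 2 ^+ 2) // -exprM mulnC exprM lerXn2r ?nnegrE ?exprn_ge0 ?ler0n //.
rewrite -natrX ler_nat; case: r r2 {sl a sumr bound} => [|[|r]] // _.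
elim: r => // r IHr; rewrite expnS; move: IHr; lia.
Qed.

(** The last two assumptions say that the diagram has rows of length at most r and at most c of
    them. Fixed points are stripped first: the dimension obeys the same branching recursion, so the
    bound for the other cycles is passed up without loss. *)
Lemma pcoef_bound n rs F (r c : nat) (l : 'I_n -> nat) :
  (0 < r + c)%N -> all (leq 2) rs -> (64 * (r + c) <= sumn rs)%N ->
  injective l -> (\sum_i l i = 'C(n, 2) + (F + sumn rs))%N ->
  (forall i, l i < n + r)%N -> (forall y, (y + c < n)%N -> y \in codom l) ->
  `|(pcoef (nseq F 1%N ++ rs) l)%:~R| <= 2^-1 ^+ sumn rs * bdim (F + sumn rs) l.
Proof.
move=> h0 rs2 hN; elim: F l => [|F IHF] l inj sl lr lc /=.
  set N := sumn rs in hN sl *; rewrite !add0n in sl *.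
  have b0 := bdim_ge0 N l; set b := bdim N l in b0 *.
  rewrite -ler_sqr ?nnegrE ?mulr_ge0 ?exprn_ge0 ?invr_ge0 //.
  rewrite real_normK ?num_real //; apply: le_trans (pcoef_sq_bound rs2 sl) _.
  rewrite -/N -/b.
  (* From N >= 64 (r + c): b >= N! / (r + c)^N >= (N / (4 (r + c)))^N >= 16^N. Hence 4^N b <= 4^(-N)
     b^2, the square of the claim. *)
  have big : 16 ^+ N <= b.
    have hook := bdim_hook_bound inj sl lr lc.
    have h1 : (64 * (r + c))%:R ^+ N <= (4 * (r + c))%:R ^+ N * b.
      apply: le_trans (_ : _ <= 4 ^+ N * N`!%:R) _.
        rewrite -!natrX -natrM ler_nat; apply: leq_trans (expn_le_fact N).
        by rewrite leq_exp2r //; move: hN h0; lia.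
      by rewrite [(4 * _)%:R]natrM exprMn -mulrA ler_wpM2l ?exprn_ge0.
    have E : (64 * (r + c))%:R = 16 * (4 * (r + c))%:R :> rat by rewrite -natrM mulnA.
    rewrite E exprMn mulrC ler_pM2l // in h1.
    by rewrite exprn_gt0 // ltr0n; move: h0; lia.
  rewrite exprMn [b ^+ 2]expr2 mulrA ler_wpM2r //.
  apply: le_trans (ler_wpM2l _ big); last by rewrite exprn_ge0 // exprn_ge0.
  rewrite -exprM mulnC exprM -exprMn.
  by rewrite (_ : 2^-1 ^+ 2 * 16 = 4) //; field.
rewrite pcoef_cons rmorph_sum /= addSn bdim_rec //.
apply: le_trans (ler_norm_sum _ _ _) _; rewrite mulr_sumr.
apply: ler_sum => i gt0; rewrite subn1.
case: (injective_or_dup (upd l i (l i).-1)) => [inj'|[a [b [nab E]]]]; last first.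
  by rewrite (pcoef_dup _ nab E) normr0 mulr_ge0 ?exprn_ge0 ?invr_ge0 ?bdim_ge0.
apply: IHF => //.
- by have := sum_upd l i (l i).-1; lia.
- by move=> k; rewrite /upd; case: eqP => _; have := lr k; have := lr i; lia.
(* A bead at a position below n - c has its lower neighbour occupied too, so lowering it would be a
   collision, against [inj']. *)
move=> y hy; have /codomP[k Ek] := lc y hy.
case: (eqVneq k i) => [Eki|nki]; last first.
  by apply/codomP; exists k; rewrite upd_neq.
have /codomP[q Eq] : (l i).-1 \in codom l by apply: lc; rewrite -Eki -Ek; lia.
have nqi : q != i by apply/eqP => Eqi; move: Eq; rewrite Eqi; lia.
have := inj' q i; rewrite upd_same upd_neq // -Eq => /(_ erefl) /eqP.
by rewrite (negPf nqi).
Qed.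

(** * Counting standard tableaux *)

(** [is_SYT] with the side B of the box separated from the number n of entries, so that removing the
    largest entry leaves the box and the number of beads unchanged. *)
Definition is_tableau n B (lam : nat -> nat) (T : {ffun 'I_n -> ('I_B * 'I_B)%type}) : bool :=
  [&& [forall t, (T t).2 < lam (T t).1]%N,
      injectiveb T &
      [forall a, forall b,
         (((T a).1 <= (T b).1) && ((T a).2 <= (T b).2))%N ==> (a <= b)%N]].

Definition beads B (lam : nat -> nat) (i : 'I_B) : nat := (lam i + (B - 1 - i))%N.

Definition remove_cell (lam : nat -> nat) (i x : nat) : nat := (lam x - (x == i))%N.

Definition extend_tableau n B (c : 'I_B * 'I_B) (T : {ffun 'I_n -> ('I_B * 'I_B)%type}) :
    {ffun 'I_n.+1 -> ('I_B * 'I_B)%type} :=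
  [ffun t => if unlift ord_max t is Some t' then T t' else c].

Lemma is_tableauP n B (lam : nat -> nat) (T : {ffun 'I_n -> ('I_B * 'I_B)%type}) :
  reflect [/\ forall t, ((T t).2 < lam (T t).1)%N, injective T &
              forall a b, ((T a).1 <= (T b).1)%N -> ((T a).2 <= (T b).2)%N -> (a <= b)%N]
          (is_tableau lam T).
Proof.
apply: (iffP and3P) => [[/forallP h1 /injectiveP h2 /forallP h3]|[h1 h2 h3]].
  split=> // a b le1 le2; have /forallP/(_ b) := h3 a.
  by rewrite le1 le2.
split; [exact/forallP | exact/injectiveP |].
by apply/forallP => a; apply/forallP => b; apply/implyP => /andP[]; exact: h3.
Qed.

Lemma extend_tableau_max n B c (T : {ffun 'I_n -> ('I_B * 'I_B)%type}) :
  extend_tableau c T ord_max = c.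
Proof. by rewrite ffunE unlift_none. Qed.

Lemma extend_tableau_lift n B c (T : {ffun 'I_n -> ('I_B * 'I_B)%type}) t :
  extend_tableau c T (lift ord_max t) = T t.
Proof. by rewrite ffunE liftK. Qed.

Lemma lift_max_val n (t : 'I_n) : lift ord_max t = t :> nat.
Proof. by rewrite /= /bump leqNgt ltn_ord. Qed.

Lemma extend_tableau_is_tableau n B (lam : nat -> nat) (c : 'I_B * 'I_B)
    (T : {ffun 'I_n -> ('I_B * 'I_B)%type}) :
  {homo lam : x y / (x <= y)%N >-> (y <= x)%N} ->
  (lam c.1.+1 < lam c.1)%N -> c.2.+1 = lam c.1 ->
  is_tableau (remove_cell lam c.1) T -> is_tableau lam (extend_tableau c T).
Proof.
move=> dec corner c2 /is_tableauP[diag inj ord].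
have diag' t : ((T t).2 < lam (T t).1 - ((T t).1 == c.1 :> nat))%N by exact: diag.
have notge t : (c.1 <= (T t).1)%N -> (c.2 <= (T t).2)%N -> False.
  move=> le1 le2; have := diag' t.
  case: eqP => [->|ne]; first by lia.
  have : (lam (T t).1 <= lam c.1.+1)%N by apply: dec; lia.
  by lia.
apply/is_tableauP; split.
- move=> t; case: (unliftP ord_max t) => [t' ->|->].
    by rewrite extend_tableau_lift; have := diag' t'; lia.
  by rewrite extend_tableau_max; lia.
- move=> a b; case: (unliftP ord_max a) => [a' ->|->];
    case: (unliftP ord_max b) => [b' ->|->] //;
    rewrite ?extend_tableau_lift ?extend_tableau_max.
  + by move/inj ->.
  + by move=> E; case: (notge a'); rewrite E.
  + by move=> E; case: (notge b'); rewrite -E.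
move=> a b; case: (unliftP ord_max a) => [a' ->|->];
    case: (unliftP ord_max b) => [b' ->|->] //;
    rewrite ?extend_tableau_lift ?extend_tableau_max.
- by rewrite !lift_max_val; exact: ord.
- by move=> _ _; exact: leq_ord.
- by move=> le1 le2; case: (notge b').
Qed.

Lemma card_diagram B (lam : nat -> nat) : (forall x, lam x <= B)%N ->
  #|[set c : 'I_B * 'I_B | (c.2 < lam c.1)%N]| = (\sum_(i < B) lam i)%N.
Proof.
move=> le; rewrite -sum1_card.
rewrite (eq_bigl (fun c : 'I_B * 'I_B => xpredT c.1 && (c.2 < lam c.1)%N)); last first.
  by move=> c; rewrite inE.
rewrite -(pair_big_dep xpredT (fun i j : 'I_B => (j < lam i)%N) (fun _ _ => 1%N)) /=.
apply: eq_bigr => i _.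
by rewrite -(big_ord_widen B (fun=> 1%N)) ?sum1_card ?card_ord.
Qed.

Lemma tableau_onto n B (lam : nat -> nat) (T : {ffun 'I_n -> ('I_B * 'I_B)%type})
    (c : 'I_B * 'I_B) :
  (forall x, lam x <= B)%N -> (\sum_(i < B) lam i = n)%N ->
  is_tableau lam T -> (c.2 < lam c.1)%N -> exists t, T t = c.
Proof.
move=> le sl /is_tableauP[diag inj _] hc.
have sub : T @: setT \subset [set c : 'I_B * 'I_B | (c.2 < lam c.1)%N].
  by apply/subsetP => _ /imsetP[t _ ->]; rewrite inE.
have := subset_leqif_card sub; rewrite card_imset // cardsT card_ord card_diagram // sl.
case=> _; rewrite eqxx => /esym/subsetP/(_ c).
by rewrite inE hc => /(_ isT)/imsetP[t _ ->]; exists t.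
Qed.

(** Every cell of the diagram carries an entry, and one weakly south-east of the largest must itself
    be the largest. So the largest entry sits in a corner. *)
Lemma tableau_max n B (lam : nat -> nat) (T : {ffun 'I_n.+1 -> ('I_B * 'I_B)%type}) :
  let c := T ord_max in
  (forall x, lam x <= B)%N -> (forall x, B <= x -> lam x = 0)%N ->
  {homo lam : x y / (x <= y)%N >-> (y <= x)%N} -> (\sum_(i < B) lam i = n.+1)%N ->
  is_tableau lam T ->
  [/\ (lam c.1.+1 < lam c.1)%N, c.2.+1 = lam c.1 &
      exists2 T', is_tableau (remove_cell lam c.1) T' & T = extend_tableau c T'].
Proof.
move=> c le out dec sl tab; have /is_tableauP[diag inj ord] := tab.
have onlymax (d : 'I_B * 'I_B) : (d.2 < lam d.1)%N -> (c.1 <= d.1)%N -> (c.2 <= d.2)%N -> d = c.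
  move=> hd le1 le2; have [t Et] := tableau_onto le sl tab hd.
  have /= := ord ord_max t; rewrite -/c Et => /(_ le1 le2) let_.
  by rewrite -Et /c; congr (T _); apply/val_inj/eqP; rewrite eqn_leq let_ /= -ltnS ltn_ord.
have hc : (c.2 < lam c.1)%N by exact: diag.
have cB : (lam c.1 - 1 < B)%N by have := le c.1; lia.
have c2 : c.2.+1 = lam c.1.
  have E : (c.1, Ordinal cB) = c by apply: onlymax => //=; lia.
  by rewrite -[in LHS]E /=; lia.
have corner : (lam c.1.+1 < lam c.1)%N.
  rewrite ltnNge; apply/negP => ge.
  have lt1 : (c.1.+1 < B)%N.
    by rewrite ltnNge; apply/negP => /out E; rewrite E in ge; lia.
  have E : (Ordinal lt1, c.2) = c by apply: onlymax => //=; lia.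
  by have := congr1 (fun d => val d.1) E => /=; lia.
split=> //; exists [ffun t => T (lift ord_max t)].
  apply/is_tableauP; split=> [t|a b|a b]; rewrite !ffunE.
  - have := diag (lift ord_max t); rewrite /remove_cell.
    case: eqP => [E|_]; last by rewrite subn0.
    have ne : T (lift ord_max t) != c.
      by rewrite (inj_eq inj) eq_sym neq_lift.
    have : (T (lift ord_max t)).2 != c.2 :> nat.
      apply: contra ne => /eqP E2; apply/eqP.
      move: E E2; case: (T _) => a b /= /ord_inj -> /ord_inj ->.
      by case: (c).
    by rewrite E; lia.
  - by move/inj/lift_inj.
  - by move=> le1 le2; rewrite -(lift_max_val a) -(lift_max_val b); exact: ord.
apply/ffunP => t; case: (unliftP ord_max t) => [t' ->|->].
  by rewrite extend_tableau_lift ffunE.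
by rewrite extend_tableau_max.
Qed.

Lemma extend_tableau_inj n B c : injective (@extend_tableau n B c).
Proof.
move=> T T' /ffunP E; apply/ffunP => t.
by have := E (lift ord_max t); rewrite !extend_tableau_lift.
Qed.

Lemma card_tableau_rec n B (lam : nat -> nat) :
  (forall x, lam x <= B)%N -> (forall x, B <= x -> lam x = 0)%N ->
  {homo lam : x y / (x <= y)%N >-> (y <= x)%N} -> (\sum_(i < B) lam i = n.+1)%N ->
  #|[pred T : {ffun 'I_n.+1 -> ('I_B * 'I_B)%type} | is_tableau lam T]| =
  (\sum_(i < B | lam i.+1 < lam i)
     #|[pred T : {ffun 'I_n -> ('I_B * 'I_B)%type} | is_tableau (remove_cell lam i) T]|)%N.
Proof.
move=> le out dec sl; rewrite -sum1_card.
rewrite (partition_big (fun T : {ffun 'I_n.+1 -> ('I_B * 'I_B)%type} => (T ord_max).1)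
   (fun i : 'I_B => lam i.+1 < lam i)%N) /=; last first.
  by move=> T tab; have [] := tableau_max le out dec sl tab.
apply: eq_bigr => i corner.
have cB : (lam i - 1 < B)%N by have := le i; lia.
pose c := (i, Ordinal cB).
rewrite sum1_card -[RHS](card_imset _ (@extend_tableau_inj n B c)).
apply: eq_card => T; apply/andP/imsetP => [[tab /eqP Ti]|[T' tab ->]].
  have [_ c2 [T' tab' ET]] := tableau_max le out dec sl tab.
  rewrite Ti in c2 tab'; exists T'; first exact: tab'.
  rewrite ET; congr (extend_tableau _ _).
  rewrite [LHS]surjective_pairing; congr (_, _); first exact: Ti.
  by apply: val_inj; rewrite /= -c2 subn1.
rewrite extend_tableau_max; split=> //; apply: extend_tableau_is_tableau => //=.
by lia.
Qed.

Lemma beads_decreasing B (lam : nat -> nat) (i j : 'I_B) :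
  {homo lam : x y / (x <= y)%N >-> (y <= x)%N} ->
  (i < j)%N -> (beads lam j < beads lam i)%N.
Proof.
move=> dec ij; rewrite /beads; have := dec i j (ltnW ij).
by have := ltn_ord j; lia.
Qed.

Lemma beads_inj B (lam : nat -> nat) : {homo lam : x y / (x <= y)%N >-> (y <= x)%N} ->
  injective (@beads B lam).
Proof.
move=> dec i j E; apply: ord_inj.
by case: (ltngtP i j) => // /(beads_decreasing dec); rewrite E ltnn.
Qed.

Lemma sum_beads B (lam : nat -> nat) : (\sum_(i < B) beads lam i = 'C(B, 2) + \sum_(i < B) lam i)%N.
Proof.
rewrite big_split /= addnC; congr (_ + _)%N.
rewrite -triangular_sum big_mkord (reindex_inj rev_ord_inj) /=.
by apply: eq_bigr => i _; have := ltn_ord i; lia.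
Qed.

Lemma card_tableau n B (lam : nat -> nat) :
  (forall x, lam x <= B)%N -> (forall x, B <= x -> lam x = 0)%N ->
  {homo lam : x y / (x <= y)%N >-> (y <= x)%N} -> (\sum_(i < B) lam i = n)%N ->
  #|[pred T : {ffun 'I_n -> ('I_B * 'I_B)%type} | is_tableau lam T]|%:R =
  bdim n (@beads B lam).
Proof.
elim: n lam => [|n IHn] lam le out dec sl.
  have gt0 := bdim_gt0 0 (beads_inj (B := B) dec).
  have sb := sum_beads B lam; rewrite sl addn0 in sb.
  (* It is positive and equal to its own square. *)
  have -> : bdim 0 (@beads B lam) = 1.
    apply: (mulIf (negbT (gt_eqF gt0))); rewrite mul1r -expr2 -[RHS](sdim0_sq sb).
    by rewrite real_normK ?num_real.
  have lam0 i : (i < B)%N -> lam i = 0%N.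
    move=> lt; apply/eqP; rewrite -leqn0 -[X in (_ <= X)%N]sl.
    by rewrite (bigD1 (Ordinal lt)) //= leq_addr.
  rewrite (eq_card (B := predT)) ?card_ffun ?card_ord ?expn0 // => T.
  by rewrite !inE; apply/is_tableauP; split=> [[]|[]|[]].
have inj := beads_inj (B := B) dec.
rewrite card_tableau_rec // bdim_rec //; last by rewrite sum_beads sl.
rewrite natr_sum big_mkcond [RHS]big_mkcond /=; apply: eq_bigr => i _.
have iB := ltn_ord i.
case: ltnP => [corner|ncorner].
  have -> : (0 < beads lam i)%N by rewrite /beads; lia.
  rewrite IHn.
  - apply: eq_bdim => k; rewrite /upd /beads /remove_cell -val_eqE /=.
    by case: (eqVneq (k : nat) i) => [->|_] /=; rewrite ?subn0 //; lia.
  - by move=> x; have := le x; rewrite /remove_cell; lia.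
  - by move=> x /out E; rewrite /remove_cell E.
  - move=> x y xy; have := dec _ _ xy; rewrite /remove_cell.
    case: (eqVneq y i) => [->|nyi]; first by lia.
    case: (eqVneq x i) => [Ex|nxi]; last by lia.
    have : (lam y <= lam i.+1)%N by apply: dec; lia.
    by rewrite Ex; lia.
  rewrite (bigD1 i) //= in sl; rewrite (bigD1 i) //= /remove_cell eqxx.
  rewrite (eq_bigr (fun j : 'I_B => lam j)) => [|j]; last first.
    by rewrite -val_eqE /= => /negPf ->; rewrite subn0.
  by lia.
(* If row i has no corner, bead i moves onto bead i+1 and the term is 0. For the last row the bead
   is then at 0 and cannot move. *)
case: ifP => // gt0; case: (ltnP i.+1 B) => [lt|ge].
  have nij : i != Ordinal lt by rewrite -val_eqE /=; lia.
  rewrite (bdim_dup _ nij) // upd_same upd_neq 1?eq_sym //.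
  by have := dec i i.+1 (leqnSn i); rewrite /beads /=; lia.
by move: gt0 ncorner; rewrite /beads (out i.+1) //; lia.
Qed.

Lemma size_le_sumn s : all (fun p => 0 < p)%N s -> (size s <= sumn s)%N.
Proof. by elim: s => //= p s IHs /andP[p0 /IHs]; lia. Qed.

Lemma nth_le_sumn s x : (nth 0 s x <= sumn s)%N.
Proof.
elim: s x => [|p s IHs] [|x] //=; first by rewrite leq_addr.
by apply: leq_trans (IHs x) _; rewrite leq_addl.
Qed.

Lemma nth_partition_mono n nu : is_partition n nu ->
  {homo nth 0%N nu : x y / (x <= y)%N >-> (y <= x)%N}.
Proof.
case/and3P => srt _ _ x y xy; case: (ltnP y (size nu)) => [lt|ge]; last first.
  by rewrite (nth_default _ ge).
have geq_trans : transitive geq by move=> a b c; rewrite /geq /= => h1 h2; exact: leq_trans h2 h1.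
by apply: (sorted_leq_nth geq_trans leqnn 0%N srt) => //; rewrite inE //; exact: leq_ltn_trans lt.
Qed.

Lemma partition_size n nu : is_partition n nu -> (size nu <= n)%N.
Proof. by case/and3P => _ pos /eqP <-; exact: size_le_sumn. Qed.

Lemma sum_partition n nu : is_partition n nu -> (\sum_(i < n) nth 0 nu i = n)%N.
Proof.
move=> part; have size_le := partition_size part; case/and3P: part => _ _ /eqP sn.
rewrite -[RHS]sn sumnE (big_nth 0%N) big_mkord [RHS](big_ord_widen n (nth 0%N nu)) //.
rewrite [RHS]big_mkcond /=; apply: eq_bigr => i _.
by case: ltnP => // ge; rewrite nth_default.
Qed.

Lemma fSYT_bdim n nu : is_partition n nu ->
  (fSYT n nu)%:R = bdim n (@beads n (nth 0%N nu)).
Proof.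
move=> part; apply: card_tableau.
- by move=> x; apply: leq_trans (nth_le_sumn _ _) _; case/and3P: part => _ _ /eqP ->.
- by move=> x nx; rewrite nth_default // (leq_trans (partition_size part)).
- exact: nth_partition_mono part.
- exact: sum_partition.
Qed.

(** * Characters and cycle types *)

Lemma porbit_conj (T : finType) (g x : {perm T}) i :
  porbit (g ^ x)%g (x i) = x @: porbit g i.
Proof.
apply/setP => j; apply/porbitP/imsetP => [[e ->]|[_ /porbitP[e ->] ->]].
  by exists ((g ^+ e)%g i); rewrite ?mem_porbit // -conjXg permJ.
by exists e; rewrite -conjXg permJ.
Qed.

Lemma porbits_conj (T : finType) (g x : {perm T}) :
  porbits (g ^ x)%g = [set x @: (C : {set T}) | C in porbits g].
Proof.
apply/setP => C; apply/imsetP/imsetP => [[i _ ->]|[_ /imsetP[i _ ->] ->]].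
  by exists (porbit g (x^-1 i)%g); rewrite ?imset_f // -porbit_conj permKV.
by exists (x i); rewrite // porbit_conj.
Qed.

Lemma irr_char_conj n nu (g x : {perm 'I_n}) :
  irr_char n nu (g ^ x)%g = irr_char n nu g.
Proof.
rewrite /irr_char /p_type porbits_conj big_imset /=; last first.
  by move=> C C' _ _; apply/imset_inj/perm_inj.
congr ((_ * _)@_ _); apply: eq_bigr => C _.
by rewrite card_imset //; exact: perm_inj.
Qed.

(** For each x substitute z = g^x. Since the irreducible character is an integer valued class
    function, the inner sum does not depend on x, and the sum over x cancels the group order. *)
Lemma lie_mult_reciprocity m k (omega : algC) nu :
  lie_mult m k omega nu = #|rect_centralizer m k|%:R^-1 *
    \sum_(z in rect_centralizer m k) rect_lin_char m k omega z * (irr_char (m * k) nu z)%:~R.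
Proof.
rewrite /lie_mult /higher_lie_rect; set Z := rect_centralizer m k.
have NZ : #|[set: {perm 'I_(m * k)}]|%:R != 0 :> algC.
  by rewrite pnatr_eq0 -lt0n; apply/card_gt0P; exists 1%g; rewrite inE.
apply: (mulfI NZ); rewrite mulrA mulfV // mul1r.
have chi_real g : ((irr_char (m * k) nu g)%:~R)^* = (irr_char (m * k) nu g)%:~R :> algC.
  by rewrite (CrealP _) ?rpred_int.
under eq_bigr => g _ do rewrite chi_real -mulrA mulr_suml.
rewrite -mulr_sumr exchange_big /= mulrCA; congr (_ * _).
rewrite mulr_natl -sumr_const; apply: eq_big => [x|x _]; first by rewrite inE.
rewrite (reindex_inj (conjg_inj x^-1)%g) /= [RHS]big_mkcond /=; apply: eq_bigr => z _.
by rewrite conjgKV irr_char_conj; case: ifP; rewrite ?mul0r.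
Qed.

Lemma sum_card_porbits n (g : {perm 'I_n}) : (\sum_(C in porbits g) #|C| = n)%N.
Proof.
rewrite -[RHS]card_ord -sum1_card (partition_big (porbit g) (mem (porbits g))) /=; last first.
  by move=> i _; apply: imset_f.
apply: eq_bigr => _ /imsetP[x _ ->]; rewrite -sum1_card; apply: eq_bigl => i.
by rewrite eq_porbit_mem.
Qed.

Lemma porbit_fixed (T : finType) (g : {perm T}) i : (#|porbit g i| == 1)%N = (g i == i).
Proof.
apply/eqP/eqP => [c1|gi]; last first.
  rewrite (_ : porbit g i = [set i]) ?cards1 //; apply/setP => j; rewrite inE.
  apply/porbitP/eqP => [[e ->]|->]; last by exists 0; rewrite perm1.
  by elim: e => [|e IHe]; rewrite ?perm1 // expgSr permM IHe.
have/cards1P[x Ex] : #|porbit g i| == 1%N by apply/eqP.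
have := porbit_id g i; have := mem_porbit g 1 i.
by rewrite Ex !inE expg1 => /eqP -> /eqP ->.
Qed.

Lemma card_porbits1 n (g : {perm 'I_n}) :
  #|[set C in porbits g | #|C| == 1]%N| = #|[set i | g i == i]|.
Proof.
rewrite -(card_in_imset (f := porbit g) (D := [set i | g i == i])).
  apply: eq_card => C; rewrite !inE; apply/andP/imsetP.
    by case=> /imsetP[i _ ->]; rewrite porbit_fixed => fi; exists i; rewrite ?inE.
  by case=> i; rewrite inE -porbit_fixed => fi ->; rewrite imset_f.
move=> i j; rewrite !inE => _ fj E; have := porbit_id g i; rewrite E.
rewrite -porbit_fixed in fj; case/cards1P: fj (porbit_id g j) => x ->.
by rewrite !inE => /eqP -> /eqP ->.
Qed.

Lemma perm_pcoef n rs rs' (l : 'I_n -> nat) :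
  perm_eq rs rs' -> pcoef rs l = pcoef rs' l.
Proof. by move=> E; rewrite /pcoef (perm_big _ E). Qed.

(** The cycle lengths may be taken in any order; the fixed points are put first, as [pcoef_bound]
    requires. *)
Lemma irr_char_cycles n nu (g : {perm 'I_n}) : exists rs,
  [/\ all (leq 2) rs, (#|[set i | g i == i]| + sumn rs = n)%N &
      irr_char n nu g = pcoef (nseq #|[set i | g i == i]| 1%N ++ rs) (@beads n (nth 0%N nu))].
Proof.
pose s := [seq #|(C : {set 'I_n})| | C <- enum (porbits g)].
have fixE : [seq c <- s | ~~ (1 < c)%N] = nseq #|[set i | g i == i]| 1%N.
  have pos c : c \in s -> (0 < c)%N.
    by case/mapP=> C; rewrite mem_enum => /imsetP[i _ ->] ->; rewrite lt0n card_porbit_neq0.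
  rewrite -card_porbits1.
  have -> : [seq c <- s | ~~ (1 < c)%N] = [seq c <- s | c == 1]%N.
    by apply: eq_in_filter => c /pos; lia.
  have /all_pred1P -> : all (pred1 1%N) [seq c <- s | c == 1]%N by exact: filter_all.
  congr nseq; rewrite size_filter count_map cardE -size_filter.
  apply/perm_size/uniq_perm => [||C]; last by rewrite mem_filter !mem_enum !inE /= andbC.
    by apply: filter_uniq; exact: enum_uniq.
  exact: enum_uniq.
have sumE : sumn s = n.
  by rewrite sumnE big_map big_enum /= sum_card_porbits.
have sP : perm_eq s (nseq #|[set i | g i == i]| 1%N ++ [seq c <- s | 1 < c]%N).
  by rewrite -fixE perm_sym perm_catC perm_filterC.
exists [seq c <- s | 1 < c]%N; split; first exact: filter_all.
  by have := perm_sumn sP; rewrite sumE sumn_cat sumn_nseq mul1n.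
rewrite -(perm_pcoef _ sP) /irr_char /pcoef /p_type big_map big_enum /=.
by congr (_@_ _).
Qed.

Lemma irr_char1 n nu : is_partition n nu ->
  (irr_char n nu 1%g)%:~R = bdim n (@beads n (nth 0%N nu)).
Proof.
move=> part; have [rs [rs2 sE ->]] := irr_char_cycles nu (1%g : {perm 'I_n}).
have fixn : #|[set i : 'I_n | (1 : {perm 'I_n})%g i == i]| = n.
  by rewrite -[RHS]card_ord; apply: eq_card => i; rewrite !inE perm1 eqxx.
rewrite fixn in sE *; have -> : rs = [::].
  by case: rs rs2 sE => //= r rs /andP[r2 _]; lia.
rewrite cats0; apply: pcoef_ones_decreasing.
  by rewrite sum_beads (sum_partition part).
move=> i j; apply: beads_decreasing; exact: nth_partition_mono part.
Qed.

Lemma irr_char_bound n nu (g : {perm 'I_n}) d : is_partition n nu -> (0 < n)%N ->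
  (#|[set i | g i == i]| + d <= n)%N -> (64 * (head 0 nu + size nu) <= d)%N ->
  `|(irr_char n nu g)%:~R| <= 2^-1 ^+ d * bdim n (@beads n (nth 0%N nu)).
Proof.
move=> part n0 fd hd; have [rs [rs2 sE ->]] := irr_char_cycles nu g.
set F := #|_| in fd sE *; have dN : (d <= sumn rs)%N by lia.
have hpos : (0 < head 0 nu + size nu)%N.
  case/and3P: part => _; case: nu hd => [|p nu] /=; last by move=> *; lia.
  by move=> _ _ /eqP; lia.
have mono := nth_partition_mono part.
apply: le_trans (_ : _ <= 2^-1 ^+ sumn rs * bdim n (@beads n (nth 0%N nu))) _; last first.
  by rewrite ler_wpM2r ?bdim_ge0 // ler_wiXn2l // invf_le1.
have sb : (\sum_(i < n) beads (nth 0%N nu) i = 'C(n, 2) + (F + sumn rs))%N.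
  by rewrite sum_beads (sum_partition part) sE.
rewrite -[n in bdim n _]sE; apply: pcoef_bound hpos rs2 _ _ sb _ _.
- exact: leq_trans dN.
- exact: beads_inj.
- move=> i; have := mono 0%N i (leq0n i); rewrite /beads nth0; have := ltn_ord i.
  by lia.
(* Such a position y is the bead of the empty row n - 1 - y. *)
move=> y hy; have yn : (n - 1 - y < n)%N by lia.
apply/codomP; exists (Ordinal yn); rewrite /beads /= nth_default; lia.
Qed.

(** * The centralizer of a rectangular permutation *)

Section RectCentralizer.

Variables (m k : nat).
Hypothesis m_gt0 : (0 < m)%N.

Lemma cell_subproof (p : 'I_k * 'I_m) : (p.1 * m + p.2 < m * k)%N.
Proof. by case: p => b t /=; have := ltn_ord b; have := ltn_ord t; nia. Qed.

Definition cell (p : 'I_k * 'I_m) : 'I_(m * k) := Ordinal (cell_subproof p).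

Lemma block_subproof (x : 'I_(m * k)) : (x %/ m < k)%N.
Proof. by rewrite ltn_divLR // [(k * m)%N]mulnC. Qed.

Definition cell_inv (x : 'I_(m * k)) : 'I_k * 'I_m :=
  (Ordinal (block_subproof x), Ordinal (ltn_pmod x m_gt0)).

Lemma cellK : cancel cell cell_inv.
Proof.
case=> b t; congr (_, _); apply: ord_inj => /=.
  by rewrite divnMDl // divn_small ?addn0.
by rewrite modnMDl modn_small.
Qed.

Lemma cell_invK : cancel cell_inv cell.
Proof. by move=> x; apply: ord_inj; rewrite /= -divn_eq. Qed.

Definition base (b : 'I_k) : 'I_(m * k) := cell (b, Ordinal m_gt0).

Lemma val_rect_cycle (x : 'I_(m * k)) :
  rect_cycle m k x = (x %/ m * m + (x %% m).+1 %% m)%N :> nat.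
Proof.
rewrite /rect_cycle val_insubd ifT //.
by have := block_subproof x; have := ltn_pmod (x %% m).+1 m_gt0; nia.
Qed.

Lemma val_iter_rect_cycle t (x : 'I_(m * k)) :
  iter t (rect_cycle m k) x = (x %/ m * m + (x %% m + t) %% m)%N :> nat.
Proof.
elim: t => [|t IHt]; first by rewrite addn0 modn_mod -divn_eq.
rewrite iterS val_rect_cycle IHt divnMDl // [((_ + t) %% m %/ m)%N]divn_small ?ltn_pmod // addn0.
by rewrite modnMDl modn_mod -addn1 modnDml addn1 addnS.
Qed.

Lemma iter_rect_cycle_base (b : 'I_k) (t : 'I_m) :
  iter t (rect_cycle m k) (base b) = cell (b, t).
Proof.
apply: ord_inj; rewrite val_iter_rect_cycle /= addn0 mulnK //.
by rewrite modnMl add0n modn_small.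
Qed.

Lemma iter_rect_cycle_m (x : 'I_(m * k)) : iter m (rect_cycle m k) x = x.
Proof. by apply: ord_inj; rewrite val_iter_rect_cycle modnDr modn_mod -divn_eq. Qed.

Lemma rect_cycle_inj t : injective (iter t (rect_cycle m k)).
Proof.
suff inj1 : injective (rect_cycle m k) by elim: t => //= t IHt x y /inj1/IHt.
move=> x y E; rewrite -(iter_rect_cycle_m x) -(iter_rect_cycle_m y).
have iterS' w : iter m (rect_cycle m k) w = iter m.-1 (rect_cycle m k) (rect_cycle m k w).
  by rewrite -iterSr prednK.
by rewrite !iterS' E.
Qed.

Lemma centralizerP (z : {perm 'I_(m * k)}) :
  reflect (forall x, z (rect_cycle m k x) = rect_cycle m k (z x))
          (z \in rect_centralizer m k).
Proof.
rewrite inE; apply: (iffP forallP) => h x; apply/eqP; first exact: h.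
by rewrite h.
Qed.

Lemma centralizer_iter (z : {perm 'I_(m * k)}) t x : z \in rect_centralizer m k ->
  z (iter t (rect_cycle m k) x) = iter t (rect_cycle m k) (z x).
Proof. by move/centralizerP => h; elim: t => //= t IHt; rewrite h IHt. Qed.

Lemma centralizer_cell (z : {perm 'I_(m * k)}) b t : z \in rect_centralizer m k ->
  z (cell (b, t)) = iter t (rect_cycle m k) (z (base b)).
Proof. by move=> zZ; rewrite -iter_rect_cycle_base centralizer_iter. Qed.

(** A block is fixed pointwise as soon as its base point is, so the number of moved points is a
    multiple of m. *)
Lemma centralizer_fixed (z : {perm 'I_(m * k)}) b t : z \in rect_centralizer m k ->
  (z (cell (b, t)) == cell (b, t)) = (z (base b) == base b).
Proof.
move=> zZ; rewrite centralizer_cell // -iter_rect_cycle_base.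
by rewrite (inj_eq (@rect_cycle_inj t)).
Qed.

Definition base_images (z : {perm 'I_(m * k)}) : {ffun 'I_k -> 'I_(m * k)} :=
  [ffun b => z (base b)].

Lemma base_images_inj : {in rect_centralizer m k &, injective base_images}.
Proof.
move=> z z' zZ z'Z /ffunP E; apply/permP => x; rewrite -(cell_invK x).
case: (cell_inv x) => b t; rewrite (centralizer_cell b t zZ) (centralizer_cell b t z'Z).
by have := E b; rewrite !ffunE => ->.
Qed.

Definition moved_bases (z : {perm 'I_(m * k)}) : nat := #|[set b | z (base b) != base b]|.

Lemma card_fixed_centralizer (z : {perm 'I_(m * k)}) : z \in rect_centralizer m k ->
  (#|[set x | z x == x]| + m * moved_bases z = m * k)%N.
Proof.
move=> zZ; have -> : #|[set x | z x == x]| = (m * #|[set b | z (base b) == base b]|)%N.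
  rewrite -sum1_card (reindex_onto cell cell_inv (fun x _ => cell_invK x)) /=.
  rewrite (eq_bigl (fun p : 'I_k * 'I_m => (p.1 \in [set b | z (base b) == base b]) && xpredT p.2)).
    rewrite -(pair_big_dep (mem [set b | z (base b) == base b]) (fun _ => xpredT)
      (fun _ _ => 1%N)) /=.
    by rewrite sum1_card card_ord sum_nat_const mulnC.
  by case=> b t; rewrite !inE cellK eqxx andbT centralizer_fixed // andbT.
rewrite -mulnDr; congr (_ * _)%N; rewrite -[RHS]card_ord -(cardC [set b | z (base b) == base b]).
by congr (_ + _)%N; apply: eq_card => b; rewrite !inE.
Qed.

Lemma moved_bases_eq0 (z : {perm 'I_(m * k)}) : z \in rect_centralizer m k ->
  moved_bases z = 0%N -> z = 1%g.
Proof.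
move=> zZ /eqP; rewrite cards_eq0 => /eqP/setP E; apply: (base_images_inj zZ).
  by apply/centralizerP => x; rewrite !perm1.
apply/ffunP => b; rewrite !ffunE perm1; apply/eqP.
by have := E b; rewrite !inE => /negbFE.
Qed.

(* A centralizing permutation is determined by the images of the base points, so the sum
   is dominated by the product over blocks of the sum over all possible images. *)
Lemma sum_centralizer_le (Q : rat) : 0 <= Q ->
  \sum_(z in rect_centralizer m k) Q ^+ moved_bases z <= (1 + (m * k)%:R * Q) ^+ k.
Proof.
move=> Q0; pose w b (y : 'I_(m * k)) : rat := if y == base b then 1 else Q.
have w0 b y : 0 <= w b y by rewrite /w; case: ifP.
have wE z : Q ^+ moved_bases z = \prod_b w b (base_images z b).
  rewrite /moved_bases -prodr_const big_mkcond /=; apply: eq_bigr => b _.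
  by rewrite inE ffunE /w if_neg.
rewrite (eq_bigr _ (fun z _ => wE z)).
rewrite -(big_imset (fun h : {ffun _} => \prod_b w b (h b)) base_images_inj) /=.
apply: le_trans (_ : _ <= \sum_(h : {ffun 'I_k -> 'I_(m * k)}) \prod_b w b (h b)) _.
  rewrite big_mkcond /=; apply: ler_sum => h _; case: ifP => // _.
  by apply: prodr_ge0.
rewrite -(bigA_distr_bigA w) -[X in _ <= _ ^+ X]card_ord -prodr_const.
apply: ler_prod => b _; rewrite sumr_ge0 //=.
rewrite (bigD1 (base b)) //= {1}/w eqxx lerD2l.
rewrite (eq_bigr (fun=> Q)) => [|y /negPf ny]; last by rewrite /w ny.
rewrite sumr_const -[Q *+ _]mulr_natl ler_wpM2r // ler_nat.
by apply: leq_trans (max_card _) _; rewrite card_ord.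
Qed.

Definition rotate_offset (u : 'I_m) (t : 'I_m) : 'I_m := Ordinal (ltn_pmod (u + t) m_gt0).

Lemma rotate_offset_inj t : injective (rotate_offset^~ t).
Proof.
move=> u v /(congr1 val) /= /eqP; rewrite eqn_modDr !modn_small // => /eqP E.
exact: val_inj.
Qed.

(** The action of the element (sigma; t) of the wreath product S_k[Z_m] on pairs of a block and an
    offset. *)
Definition wreath_fun (p : {perm 'I_k} * {ffun 'I_k -> 'I_m}) (x : 'I_(m * k)) : 'I_(m * k) :=
  let c := cell_inv x in cell (p.1 c.1, rotate_offset c.2 (p.2 c.1)).

Lemma wreath_fun_inj p : injective (wreath_fun p).
Proof.
move=> x y; rewrite /wreath_fun => /(can_inj cellK) E; apply: (can_inj cell_invK).
move: E; case: (cell_inv x) => b u; case: (cell_inv y) => b' u' E.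
have Eb : b = b' := perm_inj (congr1 fst E); subst b'.
by have /= /rotate_offset_inj -> := congr1 snd E.
Qed.

Definition wreath_perm p : {perm 'I_(m * k)} := perm (@wreath_fun_inj p).

Lemma wreath_perm_base p b : wreath_perm p (base b) = cell (p.1 b, p.2 b).
Proof.
rewrite permE /wreath_fun cellK /=; congr (cell (_, _)); apply: ord_inj => /=.
by rewrite add0n modn_small.
Qed.

Lemma wreath_perm_centralizer p : wreath_perm p \in rect_centralizer m k.
Proof.
apply/centralizerP => x; rewrite !permE; apply: ord_inj; rewrite val_rect_cycle.
have B : (cell_inv (rect_cycle m k x)).1 = (cell_inv x).1.
  apply: ord_inj; rewrite /= val_rect_cycle divnMDl //.
  by rewrite [(_ %% m %/ m)%N]divn_small ?ltn_pmod // addn0.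
rewrite /wreath_fun B; move: (p.1 _) (p.2 _) => b t /=.
rewrite divnMDl // [((_ + _) %% m %/ m)%N]divn_small ?ltn_pmod // addn0; congr (_ + _)%N.
rewrite val_rect_cycle !modnMDl !modn_mod modnDml -[((x %% m + t) %% m).+1]addn1 modnDml.
by rewrite addSn addn1.
Qed.

Lemma wreath_perm_inj : injective wreath_perm.
Proof.
move=> [s t] [s' t'] E; have H b : (s b, t b) = (s' b, t' b).
  apply: (can_inj cellK); have := wreath_perm_base (s, t) b; rewrite E wreath_perm_base.
  by move=> /= ->.
by congr (_, _); [apply/permP | apply/ffunP] => b; case: (H b).
Qed.

(** Images in the same block differ by a power of the cycle; as z commutes with it and is injective,
    the base points themselves lie in one block. *)
Lemma centralizer_block_inj (z : {perm 'I_(m * k)}) : z \in rect_centralizer m k ->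
  injective (fun b => (cell_inv (z (base b))).1).
Proof.
move=> zZ b b' E.
pose c := cell_inv (z (base b)); pose c' := cell_inv (z (base b')).
have zE b1 : z (base b1) = iter (cell_inv (z (base b1))).2 (rect_cycle m k)
                                (base (cell_inv (z (base b1))).1).
  by rewrite iter_rect_cycle_base -surjective_pairing cell_invK.
have [u Eu] : exists u, z (base b) = iter u (rect_cycle m k) (z (base b')).
  exists (c.2 + (m - c'.2))%N; rewrite (zE b) (zE b') -/c -/c' iterD.
  rewrite -[iter (m - _) _ _]iterD subnK; last exact/ltnW/ltn_ord.
  by rewrite iter_rect_cycle_m (E : c.1 = c'.1).
rewrite -centralizer_iter // in Eu; move/perm_inj/(congr1 cell_inv): Eu.
rewrite /base; set x := iter _ _ _ => Ex.
have : (cell_inv x).1 = b'.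
  apply: ord_inj; rewrite /= val_iter_rect_cycle divnMDl //.
  by rewrite [(_ %% m %/ m)%N]divn_small ?ltn_pmod // addn0 /= divnMDl // div0n addn0.
by rewrite -Ex cellK.
Qed.

Lemma card_rect_centralizer : #|rect_centralizer m k| = (m ^ k * k`!)%N.
Proof.
have -> : (m ^ k * k`! = #|{: {perm 'I_k} * {ffun 'I_k -> 'I_m}}|)%N.
  by rewrite card_prod card_ffun !card_ord mulnC card_Sn.
rewrite -(card_imset _ wreath_perm_inj); apply: eq_card => z.
apply/idP/imsetP => [zZ|[p _ ->]]; last exact: wreath_perm_centralizer.
exists (perm (centralizer_block_inj zZ), [ffun b => (cell_inv (z (base b))).2]) => //.
apply: (base_images_inj zZ (wreath_perm_centralizer _)); apply/ffunP => b.
rewrite !ffunE wreath_perm_base -[LHS]cell_invK; congr cell.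
by rewrite [LHS]surjective_pairing; congr (_, _); rewrite ?permE ?ffunE.
Qed.

End RectCentralizer.

(** * The asymptotic estimate *)

Lemma irr_char1_fSYT n nu : is_partition n nu -> irr_char n nu 1%g = fSYT n nu.
Proof.
move=> part; apply: (@intr_inj rat).
by rewrite irr_char1 // -fSYT_bdim // -pmulrn.
Qed.

Lemma exprD1n_le (x : rat) k : 0 <= x -> 2 * k%:R * x <= 1 -> (1 + x) ^+ k <= 1 + 2 * k%:R * x.
Proof.
move=> x0; elim: k => [|k IHk] h; first by rewrite expr0 mulr0 mul0r addr0.
have k0 : 0 <= k%:R :> rat by rewrite ler0n.
rewrite -natr1 in h *; have {}IHk : (1 + x) ^+ k <= 1 + 2 * k%:R * x by apply: IHk; nra.
rewrite exprS; apply: le_trans (ler_wpM2l _ IHk) _; nra.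
Qed.

(** Equality holds at 16, and afterwards ((m+1)/m)^4 <= (17/16)^4 < 2. *)
Lemma expn4_le m : (16 <= m)%N -> (m ^ 4 <= 2 ^ m)%N.
Proof.
elim: m => // m IHm; rewrite leq_eqVlt => /orP[/eqP <- //|]; rewrite ltnS => m16.
rewrite [(2 ^ m.+1)%N]expnS; apply: leq_trans (_ : _ <= 2 * m ^ 4)%N _; last first.
  by rewrite leq_mul2l IHm.
rewrite -(leq_pmul2l (m := 16 ^ 4)%N) // -expnMn mulnCA.
apply: leq_trans (_ : _ <= (17 * m) ^ 4)%N _; first by rewrite leq_exp2r //; lia.
by rewrite expnMn mulnA leq_mul2r; apply/orP; right.
Qed.

(** With E multiplied out the estimate is about integers, which carries it from [rat], where it is
    proved, to [algC], where it is used. *)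
Lemma centralizer_sum_lt m k nu E : is_partition (m * k) nu ->
  (0 < k)%N -> (k <= m)%N -> (16 <= m)%N -> (2 * E < m)%N ->
  (64 * (head 0 nu + size nu) <= m)%N ->
  (\sum_(z in rect_centralizer m k | z != 1%g) `|irr_char (m * k) nu z|) * E%:R <
  (fSYT (m * k) nu)%:R :> int.
Proof.
move=> part k0 km m16 Em hm; have m0 : (0 < m)%N by lia.
have n0 : (0 < m * k)%N by rewrite muln_gt0 m0.
rewrite -(ltr_int rat) rmorphM /= rmorph_sum /= !rmorph_nat fSYT_bdim //.
set f := bdim _ _; have f0 : 0 < f.
  by apply/bdim_gt0/beads_inj; exact: nth_partition_mono part.
pose Q : rat := 2^-1 ^+ m.
have Q0 : 0 <= Q by rewrite exprn_ge0.
pose S : rat := \sum_(z in rect_centralizer m k | z != 1%g) Q ^+ moved_bases m0 z.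
have leS : \sum_(z in rect_centralizer m k | z != 1%g) (`|irr_char (m * k) nu z|)%:~R <= S * f.
  rewrite mulr_suml; apply: ler_sum => z /andP[zZ nz].
  rewrite intr_norm -exprM; apply: irr_char_bound => //.
    by rewrite (card_fixed_centralizer m0 zZ).
  apply: leq_trans hm _; rewrite leq_pmulr // lt0n.
  by apply: contra nz => /eqP /(moved_bases_eq0 zZ) ->.
have one_in : 1%g \in rect_centralizer m k.
  by apply/centralizerP => x; rewrite !perm1.
have moved1 : moved_bases m0 (1%g : {perm 'I_(m * k)}) = 0%N.
  by apply/eqP; rewrite cards_eq0; apply/eqP/setP => b; rewrite !inE perm1 eqxx.
have S_le : 1 + S <= (1 + (m * k)%:R * Q) ^+ k.
  have := @sum_centralizer_le m k m0 Q Q0.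
  by rewrite (bigD1 1%g one_in) /= moved1 expr0.
pose x : rat := (m * k)%:R * Q.
have x0 : 0 <= x by rewrite mulr_ge0 ?ler0n.
have mpos : 0 < m%:R :> rat by rewrite ltr0n.
(* After clearing denominators this is 2 m^2 k^2 <= 2^(m+1), true since k <= m and m^4 <= 2^m. *)
have xsmall : 2 * k%:R * x <= 2 / m%:R.
  rewrite ler_pdivlMr // /x /Q exprVn mulrA -!natrM -natrX.
  rewrite mulrAC -natrM ler_pdivrMr ?ltr0n ?expn_gt0 // -natrM ler_nat.
  apply: leq_trans (_ : 2 * m ^ 4 <= _)%N; last by rewrite leq_mul2l expn4_le.
  rewrite (_ : 2 * k * (m * k) * m = 2 * (m ^ 2 * k ^ 2))%N; last by lia.
  rewrite leq_mul2l /= (_ : m ^ 4 = m ^ 2 * m ^ 2)%N; last by rewrite -expnD.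
  by rewrite leq_mul2l leq_exp2r // km orbT.
have le2m : 2 / m%:R <= 1 :> rat.
  by rewrite ler_pdivrMr // mul1r ler_nat; lia.
have := exprD1n_le x0 (le_trans xsmall le2m) => hx.
have S_small : S <= 2 / m%:R by move: S_le hx xsmall; rewrite -/x; lra.
apply: le_lt_trans (ler_wpM2r (ler0n _ E) leS) _.
rewrite mulrAC -[X in _ < X]mul1r ltr_pM2r //.
apply: le_lt_trans (ler_wpM2r (ler0n _ E) S_small) _.
by rewrite mulrAC ltr_pdivrMr // mul1r -natrM ltr_nat.
Qed.

Lemma rect_lin_char_norm m k (omega : algC) z : (0 < m)%N -> m.-primitive_root omega ->
  `|rect_lin_char m k omega z| = 1.
Proof.
move=> m0 prim; rewrite normrX; have -> : `|omega| = 1; last by rewrite expr1n.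
by apply/eqP; rewrite -(pexpr_eq1 m0) ?normr_ge0 // -normrX prim_expr_order // normr1.
Qed.

Lemma rect_lin_char1 m k (omega : algC) : rect_lin_char m k omega 1%g = 1.
Proof. by rewrite /rect_lin_char big1 ?expr0 // => i /eqP; rewrite perm1. Qed.

(** The identity of the centralizer contributes exactly the main term; the other terms carry a
    linear character of absolute value 1. *)
Lemma lie_mult_ratio_dist m k (omega : algC) nu : (0 < m)%N ->
  m.-primitive_root omega -> is_partition (m * k) nu -> (0 < fSYT (m * k) nu)%N ->
  `| lie_mult m k omega nu / ((fSYT (m * k) nu)%:R / (m ^ k * k`!)%N%:R) - 1 | <=
  (\sum_(z in rect_centralizer m k | z != 1%g) `|irr_char (m * k) nu z|)%:~R /
  (fSYT (m * k) nu)%:R.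
Proof.
move=> m0 prim part f0; rewrite lie_mult_reciprocity card_rect_centralizer //.
set Z := (m ^ k * k`!)%N; set f := fSYT _ _.
have Z_neq0 : Z%:R != 0 :> algC by rewrite pnatr_eq0 -lt0n muln_gt0 expn_gt0 m0 fact_gt0.
have f_gt0 : 0 < f%:R :> algC by rewrite ltr0n.
have one_in : 1%g \in rect_centralizer m k.
  by apply/centralizerP => x; rewrite !perm1.
rewrite (bigD1 1%g one_in) /= rect_lin_char1 mul1r irr_char1_fSYT // -/f -pmulrn.
set S := (X in f%:R + X).
have -> : Z%:R^-1 * (f%:R + S) / (f%:R / Z%:R) - 1 = S / f%:R :> algC.
  by field; rewrite Z_neq0 gt_eqF.
rewrite normrM normfV (gtr0_norm f_gt0) ler_pM2r ?invr_gt0 //.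
apply: le_trans (ler_norm_sum _ _ _) _; rewrite rmorph_sum /=; apply: ler_sum => z _.
by rewrite normrM rect_lin_char_norm // mul1r intr_norm.
Qed.

Theorem theorem4p1 (k : nat -> nat) (omega : nat -> algC)
  (hk1 : forall m, (0 < k m)%N)
  (hko : forall eps : algC, 0 < eps ->
           exists M : nat, forall m : nat, (M <= m)%N -> (k m)%:R <= eps * m%:R)
  (homega : forall m, (0 < m)%N -> m.-primitive_root (omega m))
  (nu : nat -> seq nat)
  (hnu : forall m, is_partition (m * k m) (nu m))
  (hbal : balanced (fun m => m * k m)%N nu) :
  forall eps : algC, 0 < eps ->
    exists M : nat, forall m : nat, (M <= m)%N ->
      `| lie_mult m (k m) (omega m) (nu m)
           / ((fSYT (m * k m) (nu m))%:R / (m ^ k m * (k m)`!)%N%:R) - 1 | < eps.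
Proof.
move=> eps eps0; have [a ha] := hbal.
(* Balancedness gives 64^2 (r + s)^2 <= 64^2 * 4 * a^2 * m k for the first row r and first column s,
   and this is at most m^2 once c k <= m. The successor keeps c positive, whence also k <= m. *)
pose c := (64 ^ 2 * 4 * a ^ 2).+1.
have [|M1 hM1] := hko c%:R^-1; first by rewrite invr_gt0 ltr0n.
pose E := (Num.bound eps^-1).+1.
have hE : E%:R^-1 < eps.
  rewrite invf_plt ?posrE ?ltr0n //.
  have := archi_boundP (ltW (_ : 0 < eps^-1)); rewrite invr_gt0 => /(_ eps0) /lt_trans.
  by apply; rewrite ltr_nat.
exists (maxn M1 (maxn 16 (2 * E).+1)) => m; rewrite !geq_max => /and3P[mM m16 mE].
have m0 : (0 < m)%N by lia.
have ck : (c * k m <= m)%N.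
  by have := hM1 m mM; rewrite ler_pdivlMl ?ltr0n // -natrM ler_nat.
have km : (k m <= m)%N by apply: leq_trans ck; rewrite leq_pmull.
have hm : (64 * (head 0 (nu m) + size (nu m)) <= m)%N.
  have [h1 h2] := ha m; rewrite -(leq_exp2r _ _ (isT : 0 < 2)%N).
  move: h1 h2 ck; rewrite /c; move: (head _ _) (size _) => r s.
  move=> h1 h2 ck; have [cs _] := nat_Cauchy r s.
  have hk : ((64 ^ 2 * 4 * a ^ 2).+1 * k m * m <= m ^ 2)%N by rewrite -mulnn leq_mul2r ck orbT.
  rewrite expnMn sqrnD; apply: leq_trans hk.
  apply: leq_trans (_ : 64 ^ 2 * 4 * (a ^ 2 * (m * k m)) <= _)%N; last first.
    by rewrite mulnA mulnA mulnAC; move: (64 ^ 2 * 4 * a ^ 2)%N => q; nia.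
  rewrite -[X in (_ <= X)%N]mulnA leq_mul2l; apply/orP; right; move: h1 h2 cs.
  by move: (_ * (m * _))%N (r ^ 2)%N (s ^ 2)%N (r * s)%N => A R S RS; lia.
have lt := centralizer_sum_lt (hnu m) (hk1 m) km m16 mE hm.
have f0 : (0 < fSYT (m * k m) (nu m))%N.
  rewrite -(ltr_nat int); apply: le_lt_trans lt; rewrite mulr_ge0 //.
  by apply: sumr_ge0 => z _.
apply: le_lt_trans (lie_mult_ratio_dist m0 (homega m m0) (hnu m) f0) _.
apply: lt_trans hE; rewrite ltr_pdivrMr ?ltr0n // ltr_pdivlMl ?ltr0n //.
by rewrite -(ltr_int algC) rmorphM /= !rmorph_nat mulrC in lt.
Qed.
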